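(* The symmetric 2-rig $\widehat{\mathbb{F}\mathbb{S}et}$ of finite sets (and bijections) is biinitial in the 2-category $\mathbf{RigCat}$ of rig categories; that is, for every rig category $\mathbb{S}$, the category $\mathcal{H}om_{\mathbf{RigCat}}(\widehat{\mathbb{F}\mathbb{S}et},\mathbb{S})$, whose objects are the homomorphisms of rig categories $\widehat{\mathbb{F}\mathbb{S}et}\to\mathbb{S}$ and whose morphisms are the rig transformations between them, is equivalent to the terminal category (one object and its identity morphism).
   Context: Composition is written by juxtaposition ($gf$ means $f$ followed by $g$); $xy$ abbreviates $x\bullet y$ on objects. **Rig category.** A rig category $\mathbb{S}$ is a category $\mathcal{S}$ with a symmetric monoidal structure $(+,0,a,c,l,r)$, $a_{x,y,z}:x+(y+z)\to(x+y)+z$, a second monoidal structure $(\bullet,1,a',l',r')$, $a'_{x,y,z}:x(yz)\to(xy)z$, and natural isomorphisms $d_{x,y,z}:x(y+z)\to xy+xz$, $d'_{x,y,z}:(x+y)z\to xz+yz$, $n_x:x0\to0$, $n'_x:0x\to0$ such that for all objects $x,y,z,t$: (1) $(d_{x,y,z}+id_{xt})\,d_{x,y+z,t}\,(id_x\bullet a_{y,z,t})=a_{xy,xz,xt}\,(id_{xy}+d_{x,z,t})\,d_{x,y,z+t}$ and $(d'_{x,y,t}+id_{zt})\,d'_{x+y,z,t}\,(a_{x,y,z}\bullet id_t)=a_{xt,yt,zt}\,(id_{xt}+d'_{y,z,t})\,d'_{x,y+z,t}$; (2) $d_{x,z,y}(id_x\bullet c_{y,z})=c_{xy,xz}d_{x,y,z}$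 and $d'_{z,y,x}(c_{y,z}\bullet id_x)=c_{yx,zx}d'_{y,z,x}$; (3) $l_{xy}(n_x+id_{xy})d_{x,0,y}=id_x\bullet l_y$ and $l_{xy}(n'_y+id_{xy})d'_{0,x,y}=l_x\bullet id_y$; (4) $r_{xy}(id_{xy}+n_x)d_{x,y,0}=id_x\bullet r_y$ and $r_{xy}(id_{xy}+n'_y)d'_{x,0,y}=r_x\bullet id_y$; (5) $(a'_{x,z,y}+a'_{x,t,y})d_{x,zy,ty}(id_x\bullet d'_{z,t,y})=d'_{xz,xt,y}(d_{x,z,t}\bullet id_y)a'_{x,z+t,y}$ and $n'_y(n_x\bullet id_y)a'_{x,0,y}=n_x(id_x\bullet n'_y)$; (6) $(a'_{x,y,z}+a'_{x,y,t})d_{x,yz,yt}(id_x\bullet d_{y,z,t})=d_{xy,z,t}a'_{x,y,z+t}$, $n_{xy}a'_{x,y,0}=n_x(id_x\bullet n_y)$, $d'_{ty,zy,x}(d'_{t,z,y}\bullet id_x)a'_{t+z,y,x}=(a'_{t,y,x}+a'_{z,y,x})d'_{t,z,yx}$, $n'_x(n'_y\bullet id_x)a'_{0,y,x}=n'_{yx}$; (7) $v_{xz,xt,yz,yt}(d_{x,z,t}+d_{y,z,t})d'_{x,y,z+t}=(d'_{x,y,z}+d'_{x,y,t})d_{x+y,z,t}$, where $v_{p,q,s,u}:(p+q)+(s+u)\to(p+s)+(q+u)$ is the canonical isomorphism built from $a$ and $c$; $l_0(n_x+n_y)d'_{x,y,0}=n_{x+y}$; $l_0(n'_x+n'_y)d_{0,x,y}=n'_{x+y}$;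 (8) $(l'_x+l'_y)d_{1,x,y}=l'_{x+y}$, $(r'_x+r'_y)d'_{x,y,1}=r'_{x+y}$, $n_1=l'_0$, $n'_1=r'_0$; (9) $n_0=n'_0$. A 2-rig is a rig category whose underlying category is a groupoid. A rig category is symmetric if it carries natural isomorphisms $c'_{x,y}:xy\to yx$ making $(\bullet,1,a',c',l',r')$ symmetric monoidal with $d_{z,x,y}c'_{x+y,z}=(c'_{x,z}+c'_{y,z})d'_{x,y,z}$ and $n'_xc'_{x,0}=n_x$. **Homomorphism.** A homomorphism of rig categories $\mathbb{F}=(F,\varphi^+,\varepsilon^+,\varphi^\bullet,\varepsilon^\bullet):\mathbb{S}\to\tilde{\mathbb{S}}$ is a functor $F:\mathcal{S}\to\tilde{\mathcal{S}}$ with natural isomorphisms $\varphi^+_{x,y}:F(x+y)\to Fx+Fy$ and an isomorphism $\varepsilon^+:F0\to\tilde0$ making $F$ a (strong) symmetric monoidal functor for the additive structures, and natural isomorphisms $\varphi^\bullet_{x,y}:F(xy)\to Fx\,Fy$ and an isomorphism $\varepsilon^\bullet:F1\to\tilde1$ making $F$ a (strong) monoidal functor for the multiplicative structures, such that for all $x,y,z$: $(\varphi^\bullet_{x,y}+\varphi^\bullet_{x,z})\varphi^+_{xy,xz}F(d_{x,y,z})=\tilde d_{Fx,Fy,Fz}(id_{Fx}\bullet\varphi^+_{y,z})\varphi^\bullet_{x,y+z}$; $(\varphi^\bullet_{y,x}+\varphi^\bullet_{z,x})\varphi^+_{yx,zx}F(d'_{y,z,x})=\tilde d'_{Fy,Fz,Fx}(\varphi^+_{y,z}\bullet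 id_{Fx})\varphi^\bullet_{y+z,x}$; $\varepsilon^+F(n_x)=\tilde n_{Fx}(id_{Fx}\bullet\varepsilon^+)\varphi^\bullet_{x,0}$; $\varepsilon^+F(n'_x)=\tilde n'_{Fx}(\varepsilon^+\bullet id_{Fx})\varphi^\bullet_{0,x}$. **Rig transformation.** A rig transformation $\mathbb{F}_1\Rightarrow\mathbb{F}_2$ is a natural transformation $F_1\Rightarrow F_2$ that is monoidal both for $+$ and for $\bullet$. Rig categories, homomorphisms and rig transformations form the 2-category $\mathbf{RigCat}$. **The 2-rig $\widehat{\mathbb{F}\mathbb{S}et}$.** Its underlying category is the groupoid of finite sets and bijections; $+$ is disjoint union, $\bullet$ is cartesian product, $0=\emptyset$, $1$ is a singleton, and all structural isomorphisms ($a,c,l,r,a',c',l',r',d,d',n,n'$) are the canonical bijections coming from the universal properties of coproducts and products of sets (e.g. $c'_{S,T}(s,t)=(t,s)$). *)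

(* Defs.v *)
From mathcomp Require Import all_boot.
From Stdlib Require Import FunctionalExtensionality ProofIrrelevance.

Set Implicit Arguments.
Unset Strict Implicit.
Unset Printing Implicit Defensive.

Declare Scope cat_scope.
Delimit Scope cat_scope with cat.
Local Open Scope cat_scope.

Reserved Notation "g ∘ f" (at level 40, left associativity).
Reserved Notation "x ⊕ y" (at level 50, left associativity).
Reserved Notation "x ⊗ y" (at level 38, left associativity).
Reserved Notation "f ⊞ g" (at level 50, left associativity).
Reserved Notation "f ⊠ g" (at level 38, left associativity).

(* Morphisms are compared by Leibniz equality; [g ∘ f] is "f, then g". *)
Record Category := {
  Ob :> Type;
  Hom : Ob -> Ob -> Type;
  idm : forall x, Hom x x;
  comp : forall x y z, Hom y z -> Hom x y -> Hom x z;
  comp_idl : forall x y (f : Hom x y), comp (idm y) f = f;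
  comp_idr : forall x y (f : Hom x y), comp f (idm x) = f;
  comp_assoc : forall x y z t (h : Hom z t) (g : Hom y z) (f : Hom x y),
    comp h (comp g f) = comp (comp h g) f
}.
Arguments Hom {_} _ _.
Arguments idm {_} _.
Arguments comp {_ _ _ _} _ _.
Notation "g ∘ f" := (comp g f) : cat_scope.

(* An isomorphism carries its (unique) inverse, so that a natural isomorphism
   is a family of [Iso] with a naturality equation for the forward maps. *)
Record Iso (C : Category) (x y : C) := {
  iso_mor :> Hom x y;
  iso_inv : Hom y x;
  iso_invK : iso_inv ∘ iso_mor = idm x;
  iso_morK : iso_mor ∘ iso_inv = idm y
}.
Arguments Iso {_} _ _.

Definition is_groupoid (C : Category) : Prop :=
  forall (x y : C) (f : Hom x y),
    exists g : Hom y x, g ∘ f = idm x /\ f ∘ g = idm y.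

Record Functor (C D : Category) := {
  fobj :> C -> D;
  fmap : forall x y : C, Hom x y -> Hom (fobj x) (fobj y);
  fmap_id : forall x : C, fmap (idm x) = idm (fobj x);
  fmap_comp : forall (x y z : C) (g : Hom y z) (f : Hom x y),
    fmap (g ∘ f) = fmap g ∘ fmap f
}.
Arguments fmap {_ _} _ {_ _} _.

Definition functor_id (C : Category) : Functor C C :=
  {| fobj := fun x => x; fmap := fun _ _ f => f;
     fmap_id := fun _ => erefl; fmap_comp := fun _ _ _ _ _ => erefl |}.

Program Definition functor_comp (C D E : Category)
    (G : Functor D E) (F : Functor C D) : Functor C E :=
  {| fobj := fun x => G (F x); fmap := fun _ _ f => fmap G (fmap F f) |}.
Next Obligation. by move=> *; rewrite /= !fmap_id. Qed.
Next Obligation. by move=> *; rewrite /= !fmap_comp. Qed.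

Record NatTrans (C D : Category) (F G : Functor C D) := {
  nt :> forall x : C, Hom (F x) (G x);
  nt_nat : forall (x y : C) (f : Hom x y), nt y ∘ fmap F f = fmap G f ∘ nt x
}.

Record NatIso (C D : Category) (F G : Functor C D) := {
  ni :> forall x : C, Iso (F x) (G x);
  ni_nat : forall (x y : C) (f : Hom x y), ni y ∘ fmap F f = fmap G f ∘ ni x
}.

Definition equivalent_categories (C D : Category) : Prop :=
  exists (F : Functor C D) (G : Functor D C),
    inhabited (NatIso (functor_comp G F) (functor_id C)) /\
    inhabited (NatIso (functor_comp F G) (functor_id D)).

Program Definition terminal_category : Category :=
  {| Ob := unit; Hom := fun _ _ => unit;
     idm := fun _ => tt; comp := fun _ _ _ _ _ => tt |}.
Next Obligation. by move=> ? ? []. Qed.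
Next Obligation. by move=> ? ? []. Qed.
Next Obligation. by []. Qed.

Record Monoidal (C : Category) := {
  tens : C -> C -> C;
  tensm : forall x x' y y' : C,
    Hom x x' -> Hom y y' -> Hom (tens x y) (tens x' y');
  tensm_id : forall x y : C, tensm (idm x) (idm y) = idm (tens x y);
  tensm_comp : forall (x x' x'' y y' y'' : C)
      (f' : Hom x' x'') (f : Hom x x') (g' : Hom y' y'') (g : Hom y y'),
    tensm (f' ∘ f) (g' ∘ g) = tensm f' g' ∘ tensm f g;
  munit : C;
  massoc : forall x y z : C, Iso (tens x (tens y z)) (tens (tens x y) z);
  mlunit : forall x : C, Iso (tens munit x) x;
  mrunit : forall x : C, Iso (tens x munit) x;
  massoc_nat : forall (x x' y y' z z' : C)
      (f : Hom x x') (g : Hom y y') (h : Hom z z'),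
    massoc x' y' z' ∘ tensm f (tensm g h)
    = tensm (tensm f g) h ∘ massoc x y z;
  mlunit_nat : forall (x x' : C) (f : Hom x x'),
    mlunit x' ∘ tensm (idm munit) f = f ∘ mlunit x;
  mrunit_nat : forall (x x' : C) (f : Hom x x'),
    mrunit x' ∘ tensm f (idm munit) = f ∘ mrunit x;
  mpentagon : forall x y z t : C,
    massoc (tens x y) z t ∘ massoc x y (tens z t)
    = tensm (massoc x y z) (idm t) ∘ massoc x (tens y z) t
      ∘ tensm (idm x) (massoc y z t);
  mtriangle : forall x y : C,
    tensm (mrunit x) (idm y) ∘ massoc x munit y = tensm (idm x) (mlunit y)
}.
Arguments tens {_} _ _ _.
Arguments tensm {_} _ {_ _ _ _} _ _.
Arguments munit {_} _.
Arguments massoc {_} _ _ _ _.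
Arguments mlunit {_} _ _.
Arguments mrunit {_} _ _.

(* [massoc] goes from x(yz) to (xy)z, which fixes the form of the hexagon; the
   compatibility of the symmetry with the unit isomorphisms follows from it. *)
Record Symmetry (C : Category) (M : Monoidal C) := {
  msym :> forall x y : C, Iso (tens M x y) (tens M y x);
  msym_nat : forall (x x' y y' : C) (f : Hom x x') (g : Hom y y'),
    msym x' y' ∘ tensm M f g = tensm M g f ∘ msym x y;
  msym_invol : forall x y : C, msym y x ∘ msym x y = idm (tens M x y);
  msym_hexagon : forall x y z : C,
    massoc M z x y ∘ msym (tens M x y) z ∘ massoc M x y z
    = tensm M (msym x z) (idm y) ∘ massoc M x z y
      ∘ tensm M (idm x) (msym y z)
}.

Record SymMonoidal (C : Category) := {
  sm_mon :> Monoidal C;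
  sm_sym : Symmetry sm_mon
}.

(* The canonical isomorphism (p + q) + (s + u) -> (p + s) + (q + u). *)
Definition interchange (C : Category) (A : SymMonoidal C) (p q s u : C) :
    Hom (tens A (tens A p q) (tens A s u)) (tens A (tens A p s) (tens A q u)) :=
  iso_inv (massoc A (tens A p s) q u)
  ∘ tensm A (massoc A p s q) (idm u)
  ∘ tensm A (tensm A (idm p) (sm_sym A q s)) (idm u)
  ∘ tensm A (iso_inv (massoc A p q s)) (idm u)
  ∘ massoc A (tens A p q) s u.

(* Strong monoidal structure on a functor, in the oplax direction
   F(xy) -> F x F y. *)
Record MonoidalFunctor (C D : Category) (F : Functor C D)
    (M : Monoidal C) (N : Monoidal D) := {
  mf_tens : forall x y : C, Iso (F (tens M x y)) (tens N (F x) (F y));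
  mf_unit : Iso (F (munit M)) (munit N);
  mf_tens_nat : forall (x x' y y' : C) (f : Hom x x') (g : Hom y y'),
    mf_tens x' y' ∘ fmap F (tensm M f g)
    = tensm N (fmap F f) (fmap F g) ∘ mf_tens x y;
  mf_assoc : forall x y z : C,
    tensm N (mf_tens x y) (idm (F z)) ∘ mf_tens (tens M x y) z
      ∘ fmap F (massoc M x y z)
    = massoc N (F x) (F y) (F z) ∘ tensm N (idm (F x)) (mf_tens y z)
      ∘ mf_tens x (tens M y z);
  mf_lunit : forall x : C,
    mlunit N (F x) ∘ tensm N mf_unit (idm (F x)) ∘ mf_tens (munit M) x
    = fmap F (mlunit M x);
  mf_runit : forall x : C,
    mrunit N (F x) ∘ tensm N (idm (F x)) mf_unit ∘ mf_tens x (munit M)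
    = fmap F (mrunit M x)
}.
Arguments mf_tens {_ _ _ _ _} _ _ _.
Arguments mf_unit {_ _ _ _ _} _.

Definition symmetric_monoidal_functor (C D : Category) (F : Functor C D)
    (M : SymMonoidal C) (N : SymMonoidal D) (phi : MonoidalFunctor F M N) : Prop :=
  forall x y : C,
    mf_tens phi y x ∘ fmap F (sm_sym M x y)
    = sm_sym N (F x) (F y) ∘ mf_tens phi x y.

Definition monoidal_transformation (C D : Category) (F G : Functor C D)
    (M : Monoidal C) (N : Monoidal D)
    (phi : MonoidalFunctor F M N) (psi : MonoidalFunctor G M N)
    (tau : NatTrans F G) : Prop :=
  (forall x y : C,
     mf_tens psi x y ∘ tau (tens M x y)
     = tensm N (tau x) (tau y) ∘ mf_tens phi x y) /\
  mf_unit psi ∘ tau (munit M) = mf_unit phi.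

Record BimonoidalCategory := {
  bm_cat :> Category;
  bm_add : SymMonoidal bm_cat;
  bm_mul : Monoidal bm_cat
}.

Notation "x ⊕ y" := (tens (bm_add _) x y) : cat_scope.
Notation "f ⊞ g" := (tensm (bm_add _) f g) : cat_scope.
Notation "x ⊗ y" := (tens (bm_mul _) x y) : cat_scope.
Notation "f ⊠ g" := (tensm (bm_mul _) f g) : cat_scope.
Notation zero S := (munit (bm_add S)).
Notation one S := (munit (bm_mul S)).
Notation addA := (massoc (bm_add _)).
Notation addC := (msym (sm_sym (bm_add _))).
Notation addL := (mlunit (bm_add _)).
Notation addR := (mrunit (bm_add _)).
Notation mulA := (massoc (bm_mul _)).
Notation mulL := (mlunit (bm_mul _)).
Notation mulR := (mrunit (bm_mul _)).

(* [dl], [dr], [nl], [nr] are the left and right distributors d, d' and the left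
   and right absorptions n, n'.  The multiplicative structure is not assumed
   symmetric. *)
Record RigCategory := {
  rig_bm :> BimonoidalCategory;
  dl : forall x y z : rig_bm, Iso (x ⊗ (y ⊕ z)) (x ⊗ y ⊕ x ⊗ z);
  dr : forall x y z : rig_bm, Iso ((x ⊕ y) ⊗ z) (x ⊗ z ⊕ y ⊗ z);
  nl : forall x : rig_bm, Iso (x ⊗ zero rig_bm) (zero rig_bm);
  nr : forall x : rig_bm, Iso (zero rig_bm ⊗ x) (zero rig_bm);

  dl_nat : forall (x x' y y' z z' : rig_bm)
      (f : Hom x x') (g : Hom y y') (h : Hom z z'),
    dl x' y' z' ∘ (f ⊠ (g ⊞ h)) = (f ⊠ g ⊞ f ⊠ h) ∘ dl x y z;
  dr_nat : forall (x x' y y' z z' : rig_bm)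
      (f : Hom x x') (g : Hom y y') (h : Hom z z'),
    dr x' y' z' ∘ ((f ⊞ g) ⊠ h) = (f ⊠ h ⊞ g ⊠ h) ∘ dr x y z;
  nl_nat : forall (x x' : rig_bm) (f : Hom x x'),
    nl x' ∘ (f ⊠ idm (zero rig_bm)) = nl x;
  nr_nat : forall (x x' : rig_bm) (f : Hom x x'),
    nr x' ∘ (idm (zero rig_bm) ⊠ f) = nr x;

  dl_addA : forall x y z t : rig_bm,
    (dl x y z ⊞ idm (x ⊗ t)) ∘ dl x (y ⊕ z) t ∘ (idm x ⊠ addA y z t)
    = addA (x ⊗ y) (x ⊗ z) (x ⊗ t) ∘ (idm (x ⊗ y) ⊞ dl x z t)
      ∘ dl x y (z ⊕ t);
  dr_addA : forall x y z t : rig_bm,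
    (dr x y t ⊞ idm (z ⊗ t)) ∘ dr (x ⊕ y) z t ∘ (addA x y z ⊠ idm t)
    = addA (x ⊗ t) (y ⊗ t) (z ⊗ t) ∘ (idm (x ⊗ t) ⊞ dr y z t)
      ∘ dr x (y ⊕ z) t;

  dl_addC : forall x y z : rig_bm,
    dl x z y ∘ (idm x ⊠ addC y z) = addC (x ⊗ y) (x ⊗ z) ∘ dl x y z;
  dr_addC : forall x y z : rig_bm,
    dr z y x ∘ (addC y z ⊠ idm x) = addC (y ⊗ x) (z ⊗ x) ∘ dr y z x;

  dl_addL : forall x y : rig_bm,
    addL (x ⊗ y) ∘ (nl x ⊞ idm (x ⊗ y)) ∘ dl x (zero rig_bm) y
    = idm x ⊠ addL y;
  dr_addL : forall x y : rig_bm,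
    addL (x ⊗ y) ∘ (nr y ⊞ idm (x ⊗ y)) ∘ dr (zero rig_bm) x y
    = addL x ⊠ idm y;

  dl_addR : forall x y : rig_bm,
    addR (x ⊗ y) ∘ (idm (x ⊗ y) ⊞ nl x) ∘ dl x y (zero rig_bm)
    = idm x ⊠ addR y;
  dr_addR : forall x y : rig_bm,
    addR (x ⊗ y) ∘ (idm (x ⊗ y) ⊞ nr y) ∘ dr x (zero rig_bm) y
    = addR x ⊠ idm y;

  dl_dr_mulA : forall x y z t : rig_bm,
    (mulA x z y ⊞ mulA x t y) ∘ dl x (z ⊗ y) (t ⊗ y) ∘ (idm x ⊠ dr z t y)
    = dr (x ⊗ z) (x ⊗ t) y ∘ (dl x z t ⊠ idm y) ∘ mulA x (z ⊕ t) y;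
  nl_nr_mulA : forall x y : rig_bm,
    nr y ∘ (nl x ⊠ idm y) ∘ mulA x (zero rig_bm) y = nl x ∘ (idm x ⊠ nr y);

  dl_mulA : forall x y z t : rig_bm,
    (mulA x y z ⊞ mulA x y t) ∘ dl x (y ⊗ z) (y ⊗ t) ∘ (idm x ⊠ dl y z t)
    = dl (x ⊗ y) z t ∘ mulA x y (z ⊕ t);
  nl_mulA : forall x y : rig_bm,
    nl (x ⊗ y) ∘ mulA x y (zero rig_bm) = nl x ∘ (idm x ⊠ nl y);
  dr_mulA : forall x y z t : rig_bm,
    dr (t ⊗ y) (z ⊗ y) x ∘ (dr t z y ⊠ idm x) ∘ mulA (t ⊕ z) y x
    = (mulA t y x ⊞ mulA z y x) ∘ dr t z (y ⊗ x);
  nr_mulA : forall x y : rig_bm,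
    nr x ∘ (nr y ⊠ idm x) ∘ mulA (zero rig_bm) y x = nr (y ⊗ x);

  dl_dr_interchange : forall x y z t : rig_bm,
    interchange (bm_add rig_bm) (x ⊗ z) (x ⊗ t) (y ⊗ z) (y ⊗ t)
      ∘ (dl x z t ⊞ dl y z t) ∘ dr x y (z ⊕ t)
    = (dr x y z ⊞ dr x y t) ∘ dl (x ⊕ y) z t;
  nl_add : forall x y : rig_bm,
    addL (zero rig_bm) ∘ (nl x ⊞ nl y) ∘ dr x y (zero rig_bm) = nl (x ⊕ y);
  nr_add : forall x y : rig_bm,
    addL (zero rig_bm) ∘ (nr x ⊞ nr y) ∘ dl (zero rig_bm) x y = nr (x ⊕ y);

  dl_mulL : forall x y : rig_bm,
    (mulL x ⊞ mulL y) ∘ dl (one rig_bm) x y = mulL (x ⊕ y);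
  dr_mulR : forall x y : rig_bm,
    (mulR x ⊞ mulR y) ∘ dr x y (one rig_bm) = mulR (x ⊕ y);
  nl_one : iso_mor (nl (one rig_bm)) = mulL (zero rig_bm);
  nr_one : iso_mor (nr (one rig_bm)) = mulR (zero rig_bm);

  nl_nr_zero : iso_mor (nl (zero rig_bm)) = nr (zero rig_bm)
}.
Arguments dl {_} _ _ _.
Arguments dr {_} _ _ _.
Arguments nl {_} _.
Arguments nr {_} _.

Record RigSymmetry (S : RigCategory) := {
  mulC :> Symmetry (bm_mul S);
  dl_mulC : forall x y z : S,
    dl z x y ∘ mulC (x ⊕ y) z = (mulC x z ⊞ mulC y z) ∘ dr x y z;
  nr_mulC : forall x : S, nr x ∘ mulC x (zero S) = nl x
}.

Record SymmetricTwoRig := {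
  s2r_rig :> RigCategory;
  s2r_groupoid : is_groupoid s2r_rig;
  s2r_sym : RigSymmetry s2r_rig
}.

Record RigHom (S T : RigCategory) := {
  rh_fun :> Functor S T;
  rh_add : MonoidalFunctor rh_fun (bm_add S) (bm_add T);
  rh_mul : MonoidalFunctor rh_fun (bm_mul S) (bm_mul T);
  rh_add_sym : symmetric_monoidal_functor rh_add;
  rh_dl : forall x y z : S,
    (mf_tens rh_mul x y ⊞ mf_tens rh_mul x z)
      ∘ mf_tens rh_add (x ⊗ y) (x ⊗ z) ∘ fmap rh_fun (dl x y z)
    = dl (rh_fun x) (rh_fun y) (rh_fun z)
      ∘ (idm (rh_fun x) ⊠ mf_tens rh_add y z) ∘ mf_tens rh_mul x (y ⊕ z);
  rh_dr : forall x y z : S,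
    (mf_tens rh_mul y x ⊞ mf_tens rh_mul z x)
      ∘ mf_tens rh_add (y ⊗ x) (z ⊗ x) ∘ fmap rh_fun (dr y z x)
    = dr (rh_fun y) (rh_fun z) (rh_fun x)
      ∘ (mf_tens rh_add y z ⊠ idm (rh_fun x)) ∘ mf_tens rh_mul (y ⊕ z) x;
  rh_nl : forall x : S,
    mf_unit rh_add ∘ fmap rh_fun (nl x)
    = nl (rh_fun x) ∘ (idm (rh_fun x) ⊠ mf_unit rh_add)
      ∘ mf_tens rh_mul x (zero S);
  rh_nr : forall x : S,
    mf_unit rh_add ∘ fmap rh_fun (nr x)
    = nr (rh_fun x) ∘ (mf_unit rh_add ⊠ idm (rh_fun x))
      ∘ mf_tens rh_mul (zero S) x
}.

Record RigTrans (S T : RigCategory) (F G : RigHom S T) := {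
  rt_nt :> NatTrans F G;
  rt_add : monoidal_transformation (rh_add F) (rh_add G) rt_nt;
  rt_mul : monoidal_transformation (rh_mul F) (rh_mul G) rt_nt
}.

(* The laws of a rig transformation are propositions, hence do not contribute to
   equality of rig transformations. *)
Lemma RigTrans_ext (S T : RigCategory) (F G : RigHom S T)
    (s t : RigTrans F G) : (forall x, s x = t x) -> s = t.
Proof.
case: s t => [[s sn] sa sm] [[t tn] ta tm] /= e.
have st : s = t by exact: functional_extensionality_dep.
case: t / st {e} in tn ta tm *.
case: tn / (proof_irrelevance _ sn tn) in ta tm *.
by rewrite (proof_irrelevance _ sa ta) (proof_irrelevance _ sm tm).
Qed.

Definition nattrans_id (C D : Category) (F : Functor C D) : NatTrans F F.
Proof.
exists (fun x => idm (F x)) => x y f.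
by rewrite comp_idl comp_idr.
Defined.

Definition nattrans_comp (C D : Category) (F G H : Functor C D)
    (t : NatTrans G H) (s : NatTrans F G) : NatTrans F H.
Proof.
exists (fun x => t x ∘ s x) => x y f.
by rewrite -comp_assoc nt_nat comp_assoc nt_nat comp_assoc.
Defined.

Lemma monoidal_transformation_id (C D : Category) (F : Functor C D)
    (M : Monoidal C) (N : Monoidal D) (phi : MonoidalFunctor F M N) :
  monoidal_transformation phi phi (nattrans_id F).
Proof. by split=> [x y|] /=; rewrite ?tensm_id comp_idr ?comp_idl. Qed.

Lemma monoidal_transformation_comp (C D : Category) (F G H : Functor C D)
    (M : Monoidal C) (N : Monoidal D) (phi : MonoidalFunctor F M N)
    (psi : MonoidalFunctor G M N) (chi : MonoidalFunctor H M N)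
    (t : NatTrans G H) (s : NatTrans F G) :
  monoidal_transformation psi chi t -> monoidal_transformation phi psi s ->
  monoidal_transformation phi chi (nattrans_comp t s).
Proof.
move=> [t2 t0] [s2 s0]; split=> [x y|] /=.
  by rewrite tensm_comp comp_assoc t2 -comp_assoc s2 comp_assoc.
by rewrite comp_assoc t0.
Qed.

Definition rigtrans_id (S T : RigCategory) (F : RigHom S T) : RigTrans F F :=
  {| rt_nt := nattrans_id F;
     rt_add := monoidal_transformation_id (rh_add F);
     rt_mul := monoidal_transformation_id (rh_mul F) |}.

Definition rigtrans_comp (S T : RigCategory) (F G H : RigHom S T)
    (t : RigTrans G H) (s : RigTrans F G) : RigTrans F H :=
  {| rt_nt := nattrans_comp t s;
     rt_add := monoidal_transformation_comp (rt_add t) (rt_add s);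
     rt_mul := monoidal_transformation_comp (rt_mul t) (rt_mul s) |}.

(* The hom-category of the 2-category of rig categories, under vertical
   composition. *)
Program Definition Hom_RigCat (S T : RigCategory) : Category :=
  {| Ob := RigHom S T; Hom := @RigTrans S T;
     idm := @rigtrans_id S T; comp := @rigtrans_comp S T |}.
Next Obligation. by move=> *; apply: RigTrans_ext => ?; exact: comp_idl. Qed.
Next Obligation. by move=> *; apply: RigTrans_ext => ?; exact: comp_idr. Qed.
Next Obligation. by move=> *; apply: RigTrans_ext => ?; exact: comp_assoc. Qed.

Record bij (S T : Type) := Bij {
  bij_fun :> S -> T;
  bij_inv : T -> S;
  bij_funK : cancel bij_fun bij_inv;
  bij_invK : cancel bij_inv bij_fun
}.

Lemma bij_ext (S T : Type) (f g : bij S T) : f =1 g -> f = g.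
Proof.
case: f g => [f f' fK f'K] [g g' gK g'K] /= e.
have fg : f = g by exact: functional_extensionality.
case: g / fg {e} in gK g'K *.
have fg' : f' = g'.
  by apply: functional_extensionality => y; rewrite -{1}(g'K y) fK.
case: g' / fg' in gK g'K *.
by rewrite (proof_irrelevance _ fK gK) (proof_irrelevance _ f'K g'K).
Qed.

Definition bij_id (S : Type) : bij S S := @Bij S S id id (frefl _) (frefl _).

Definition bij_comp (S T U : Type) (g : bij T U) (f : bij S T) : bij S U :=
  @Bij S U (g \o f) (bij_inv f \o bij_inv g)
    (can_comp (bij_funK g) (bij_funK f)) (can_comp (bij_invK f) (bij_invK g)).

Definition bij_sym (S T : Type) (f : bij S T) : bij T S :=
  Bij (bij_invK f) (bij_funK f).

(* Objects are all finite types, not only the skeleton of the ordinals ['I_n]. *)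
Program Definition FSet_cat : Category :=
  {| Ob := finType; Hom := fun S T : finType => bij S T;
     idm := fun S : finType => bij_id S;
     comp := fun S T U : finType => @bij_comp S T U |}.
Next Obligation. by move=> *; apply: bij_ext. Qed.
Next Obligation. by move=> *; apply: bij_ext. Qed.
Next Obligation. by move=> *; apply: bij_ext. Qed.

Program Definition FSet_iso (S T : finType) (f : bij S T) : @Iso FSet_cat S T :=
  {| iso_mor := f; iso_inv := bij_sym f |}.
Next Obligation. by move=> S T f; apply: bij_ext => x; exact: bij_funK. Qed.
Next Obligation. by move=> S T f; apply: bij_ext => x; exact: bij_invK. Qed.

Lemma FSet_groupoid : is_groupoid FSet_cat.
Proof.
move=> S T f; exists (bij_sym f).
by split; apply: bij_ext => x; [exact: bij_funK | exact: bij_invK].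
Qed.

Ltac bij_cases :=
  repeat match goal with
  | |- forall x : (_ + _)%type, _ => case
  | |- forall x : (_ * _)%type, _ => case
  | |- forall x : unit, _ => case
  | |- forall x : void, _ => case
  | |- forall x, _ => move=> ?
  end.

Definition sum_map (S S' T T' : Type) (f : S -> S') (g : T -> T')
    (x : S + T) : S' + T' :=
  match x with inl s => inl (f s) | inr t => inr (g t) end.

Definition prod_map (S S' T T' : Type) (f : S -> S') (g : T -> T')
    (x : S * T) : S' * T' := (f x.1, g x.2).

Program Definition bij_sum (S S' T T' : Type) (f : bij S S') (g : bij T T') :
    bij (S + T) (S' + T') :=
  @Bij _ _ (sum_map f g) (sum_map (bij_inv f) (bij_inv g)) _ _.
Next Obligation. by move=> S S' T T' f g; case=> ? /=; rewrite bij_funK. Qed.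
Next Obligation. by move=> S S' T T' f g; case=> ? /=; rewrite bij_invK. Qed.

Program Definition bij_prod (S S' T T' : Type) (f : bij S S') (g : bij T T') :
    bij (S * T) (S' * T') :=
  @Bij _ _ (prod_map f g) (prod_map (bij_inv f) (bij_inv g)) _ _.
Next Obligation. by move=> S S' T T' f g; case=> *; rewrite /prod_map /= !bij_funK. Qed.
Next Obligation. by move=> S S' T T' f g; case=> *; rewrite /prod_map /= !bij_invK. Qed.

Program Definition bij_sumA (S T U : Type) : bij (S + (T + U)) (S + T + U) :=
  @Bij _ _
    (fun x => match x with
       | inl s => inl (inl s) | inr (inl t) => inl (inr t) | inr (inr u) => inr u
       end)
    (fun x => match x with
       | inl (inl s) => inl s | inl (inr t) => inr (inl t) | inr u => inr (inr u)
       end) _ _.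
Next Obligation. by rewrite /cancel; bij_cases. Qed.
Next Obligation. by rewrite /cancel; bij_cases. Qed.

Program Definition bij_sumC (S T : Type) : bij (S + T) (T + S) :=
  @Bij _ _
    (fun x => match x with inl s => inr s | inr t => inl t end)
    (fun x => match x with inl t => inr t | inr s => inl s end) _ _.
Next Obligation. by rewrite /cancel; bij_cases. Qed.
Next Obligation. by rewrite /cancel; bij_cases. Qed.

Program Definition bij_sum0l (S : Type) : bij (void + S) S :=
  @Bij _ _ (fun x => match x with inl v => match v with end | inr s => s end)
    inr _ _.
Next Obligation. by rewrite /cancel; bij_cases. Qed.
Next Obligation. by rewrite /cancel; bij_cases. Qed.

Program Definition bij_sum0r (S : Type) : bij (S + void) S :=
  @Bij _ _ (fun x => match x with inl s => s | inr v => match v with end end)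
    inl _ _.
Next Obligation. by rewrite /cancel; bij_cases. Qed.
Next Obligation. by rewrite /cancel; bij_cases. Qed.

Program Definition bij_prodA (S T U : Type) : bij (S * (T * U)) (S * T * U) :=
  @Bij _ _ (fun x => (x.1, x.2.1, x.2.2)) (fun x => (x.1.1, (x.1.2, x.2))) _ _.
Next Obligation. by rewrite /cancel; bij_cases. Qed.
Next Obligation. by rewrite /cancel; bij_cases. Qed.

Program Definition bij_prodC (S T : Type) : bij (S * T) (T * S) :=
  @Bij _ _ (fun x => (x.2, x.1)) (fun x => (x.2, x.1)) _ _.
Next Obligation. by rewrite /cancel; bij_cases. Qed.
Next Obligation. by rewrite /cancel; bij_cases. Qed.

Program Definition bij_prod1l (S : Type) : bij (unit * S) S :=
  @Bij _ _ snd (fun s => (tt, s)) _ _.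
Next Obligation. by rewrite /cancel; bij_cases. Qed.
Next Obligation. by rewrite /cancel; bij_cases. Qed.

Program Definition bij_prod1r (S : Type) : bij (S * unit) S :=
  @Bij _ _ fst (fun s => (s, tt)) _ _.
Next Obligation. by rewrite /cancel; bij_cases. Qed.
Next Obligation. by rewrite /cancel; bij_cases. Qed.

Program Definition bij_dl (S T U : Type) : bij (S * (T + U)) (S * T + S * U) :=
  @Bij _ _
    (fun x => match x.2 with inl t => inl (x.1, t) | inr u => inr (x.1, u) end)
    (fun x => match x with
       | inl y => (y.1, inl y.2) | inr y => (y.1, inr y.2) end) _ _.
Next Obligation. by rewrite /cancel; bij_cases. Qed.
Next Obligation. by rewrite /cancel; bij_cases. Qed.

Program Definition bij_dr (S T U : Type) : bij ((S + T) * U) (S * U + T * U) :=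
  @Bij _ _
    (fun x => match x.1 with inl s => inl (s, x.2) | inr t => inr (t, x.2) end)
    (fun x => match x with
       | inl y => (inl y.1, y.2) | inr y => (inr y.1, y.2) end) _ _.
Next Obligation. by rewrite /cancel; bij_cases. Qed.
Next Obligation. by rewrite /cancel; bij_cases. Qed.

Program Definition bij_nl (S : Type) : bij (S * void) void :=
  @Bij _ _ snd (fun v => match v with end) _ _.
Next Obligation. by rewrite /cancel; bij_cases. Qed.
Next Obligation. by rewrite /cancel; bij_cases. Qed.

Program Definition bij_nr (S : Type) : bij (void * S) void :=
  @Bij _ _ fst (fun v => match v with end) _ _.
Next Obligation. by rewrite /cancel; bij_cases. Qed.
Next Obligation. by rewrite /cancel; bij_cases. Qed.

Ltac bij_law := intros; apply: bij_ext; rewrite /eqfun /=; bij_cases => //=.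

Program Definition FSet_add_mon : Monoidal FSet_cat :=
  {| tens := fun S T : finType => (S + T)%type : finType;
     tensm := fun (S S' T T' : finType) (f : bij S S') (g : bij T T') => bij_sum f g;
     munit := void : finType;
     massoc := fun S T U : finType => FSet_iso (bij_sumA S T U);
     mlunit := fun S : finType => FSet_iso (bij_sum0l S);
     mrunit := fun S : finType => FSet_iso (bij_sum0r S) |}.
Solve All Obligations with bij_law.

Program Definition FSet_add : SymMonoidal FSet_cat :=
  {| sm_mon := FSet_add_mon;
     sm_sym := {| msym := fun S T : finType => FSet_iso (bij_sumC S T) |} |}.
Solve All Obligations with bij_law.

Program Definition FSet_mul : Monoidal FSet_cat :=
  {| tens := fun S T : finType => (S * T)%type : finType;
     tensm := fun (S S' T T' : finType) (f : bij S S') (g : bij T T') => bij_prod f g;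
     munit := unit : finType;
     massoc := fun S T U : finType => FSet_iso (bij_prodA S T U);
     mlunit := fun S : finType => FSet_iso (bij_prod1l S);
     mrunit := fun S : finType => FSet_iso (bij_prod1r S) |}.
Solve All Obligations with bij_law.

Program Definition FSet_rig : RigCategory :=
  {| rig_bm := {| bm_cat := FSet_cat; bm_add := FSet_add; bm_mul := FSet_mul |};
     dl := fun S T U : finType => FSet_iso (bij_dl S T U);
     dr := fun S T U : finType => FSet_iso (bij_dr S T U);
     nl := fun S : finType => FSet_iso (bij_nl S);
     nr := fun S : finType => FSet_iso (bij_nr S) |}.
Solve All Obligations with bij_law.

Program Definition FSet_mulC : Symmetry FSet_mul :=
  {| msym := fun S T : finType => FSet_iso (bij_prodC S T) |}.
Solve All Obligations with bij_law.

Program Definition FSet_sym : RigSymmetry FSet_rig :=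
  {| mulC := FSet_mulC |}.
Solve All Obligations with bij_law.

Definition FSet_hat : SymmetricTwoRig :=
  {| s2r_rig := FSet_rig; s2r_groupoid := FSet_groupoid; s2r_sym := FSet_sym |}.

(* Main.v *)
From mathcomp Require Import all_boot.
From Stdlib Require Import ProofIrrelevance.
Require Import Defs.

(** A finite set is a sum of copies of the one-point set, so a homomorphism out
    of the rig of finite sets is, up to a unique transformation, forced on
    objects: it sends a set with [n] points to [1 + ... + 1].  The content of
    the theorem is that this prescription is coherent.

    For the additive structure alone the statement is that finite sets and
    bijections form the free symmetric monoidal category on one object.  Its two
    halves are proved on a syntax of bracketed sums ([tree]) and of formal
    structural isomorphisms between them ([term]), which can be evaluated in any
    symmetric monoidal category with a chosen object, and in particular in
    finite sets.  [term_coherence] says that two terms inducing the same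
    bijection of leaves have the same value everywhere; [term_full] says that
    every bijection of leaves is induced by a term.  Together they give a
    symmetric monoidal functor with a prescribed value at the point
    ([free_monoidal], [free_symmetric]), and an extension of every isomorphism
    between the values at the point of two such functors to a monoidal
    transformation ([extend]), unique by [monoidal_transformation_uniq].

    The multiplicative structure is then derived from this additive universal
    property.  For a fixed set [Y], distributivity makes both [F (X * Y)] and
    [F X * F Y] symmetric monoidal functors of [X]; they are isomorphic at
    [X = 1] by the unit laws, so there is a unique additive comparison between them.  Every law
    that this comparison has to satisfy, as well as the compatibility of an
    additive transformation with products, is an equation depending on [X] which
    can be checked for [X = 0], for [X = 1] and for a sum of two sets for which
    it holds ([generated_by_one]); in each of these cases it is one of the axioms
    of a rig category.  This yields the homomorphism [FSet_hom], and shows that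
    between two homomorphisms there is exactly one rig transformation
    ([comparison], [comparison_uniq]). *)

Set Implicit Arguments.
Unset Strict Implicit.
Unset Printing Implicit Defensive.
Local Open Scope cat_scope.

(** * Isomorphisms in a category *)

Section Composition.
Variable C : Category.

(** With composites bracketed to the left, an equation between composites is not
    visible below a further factor; [reassoc2] and [reassoc3] restate it so that
    it can be used there for rewriting. *)
Lemma reassoc2 (x y z t : C) (g : Hom y z) (f : Hom x y) (k : Hom x z) :
  g ∘ f = k -> forall h : Hom z t, h ∘ g ∘ f = h ∘ k.
Proof. by move=> <- h; rewrite comp_assoc. Qed.

Lemma reassoc3 (x y z t w : C) (g : Hom z t) (f : Hom y z) (e : Hom x y)
    (k : Hom x t) :
  g ∘ f ∘ e = k -> forall h : Hom t w, h ∘ g ∘ f ∘ e = h ∘ k.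
Proof. by move=> <- h; rewrite !comp_assoc. Qed.

Lemma iso_epi (x y z : C) (i : Iso x y) (f g : Hom y z) :
  f ∘ i = g ∘ i -> f = g.
Proof.
move=> e; rewrite -[f]comp_idr -[g]comp_idr -(iso_morK i).
by rewrite !comp_assoc e.
Qed.

Lemma iso_mono (x y z : C) (i : Iso y z) (f g : Hom x y) :
  i ∘ f = i ∘ g -> f = g.
Proof.
move=> e; rewrite -[f]comp_idl -[g]comp_idl -(iso_invK i).
by rewrite -!comp_assoc e.
Qed.

Definition iso_id (x : C) : Iso x x :=
  {| iso_invK := comp_idl (idm x); iso_morK := comp_idl (idm x) |}.

Definition iso_sym (x y : C) (i : Iso x y) : Iso y x :=
  {| iso_invK := iso_morK i; iso_morK := iso_invK i |}.

Program Definition iso_comp (x y z : C) (j : Iso y z) (i : Iso x y) : Iso x z :=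
  {| iso_mor := j ∘ i; iso_inv := iso_inv i ∘ iso_inv j |}.
Next Obligation.
by move=> x y z j i; rewrite comp_assoc (reassoc2 (iso_invK j)) comp_idr iso_invK.
Qed.
Next Obligation.
by move=> x y z j i; rewrite comp_assoc (reassoc2 (iso_morK i)) comp_idr iso_morK.
Qed.

(** This transfers the naturality of an isomorphism to its inverse. *)
Lemma iso_inv_swap (x y x' y' : C) (i : Iso x y) (j : Iso x' y')
    (f : Hom x x') (g : Hom y y') :
  j ∘ f = g ∘ i -> iso_inv j ∘ g = f ∘ iso_inv i.
Proof.
move=> e; apply: (iso_mono (i := j)); apply: (iso_epi (i := i)).
rewrite !comp_assoc iso_morK comp_idl -(comp_assoc _ (iso_inv i)) iso_invK.
by rewrite comp_idr e.
Qed.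

End Composition.

Lemma fmap_invK (C D : Category) (F : Functor C D) (x y : C) (i : Iso x y) :
  fmap F (iso_inv i) ∘ fmap F i = idm (F x).
Proof. by rewrite -fmap_comp iso_invK fmap_id. Qed.

Lemma fmap_morK (C D : Category) (F : Functor C D) (x y : C) (i : Iso x y) :
  fmap F i ∘ fmap F (iso_inv i) = idm (F y).
Proof. by rewrite -fmap_comp iso_morK fmap_id. Qed.

Definition fmap_iso (C D : Category) (F : Functor C D) (x y : C) (i : Iso x y) :
    Iso (F x) (F y) :=
  {| iso_invK := fmap_invK F i; iso_morK := fmap_morK F i |}.

(** * Unit coherence in monoidal categories *)

Section MonoidalFacts.
Variables (C : Category) (M : Monoidal C).
Local Notation "x ⋄ y" := (tens M x y) (at level 50, left associativity).
Local Notation "f ◇ g" := (tensm M f g) (at level 39, left associativity).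
Local Notation "0" := (munit M).
Local Notation al := (massoc M).

Program Definition iso_tens (x x' y y' : C) (i : Iso x x') (j : Iso y y') :
    Iso (x ⋄ y) (x' ⋄ y') :=
  {| iso_mor := i ◇ j; iso_inv := iso_inv i ◇ iso_inv j |}.
Next Obligation. by move=> *; rewrite -tensm_comp !iso_invK tensm_id. Qed.
Next Obligation. by move=> *; rewrite -tensm_comp !iso_morK tensm_id. Qed.

Lemma tensm_compl (x y z w : C) (g : Hom y z) (f : Hom x y) :
  (g ∘ f) ◇ idm w = (g ◇ idm w) ∘ (f ◇ idm w).
Proof. by rewrite -tensm_comp comp_idl. Qed.

Lemma tensm_compr (x y z w : C) (g : Hom y z) (f : Hom x y) :
  idm w ◇ (g ∘ f) = (idm w ◇ g) ∘ (idm w ◇ f).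
Proof. by rewrite -tensm_comp comp_idl. Qed.

Lemma tensm_lr (x x' y y' : C) (f : Hom x x') (g : Hom y y') :
  (f ◇ idm y') ∘ (idm x ◇ g) = f ◇ g.
Proof. by rewrite -tensm_comp comp_idl comp_idr. Qed.

Lemma tensm_rl (x x' y y' : C) (f : Hom x x') (g : Hom y y') :
  (idm x' ◇ g) ∘ (f ◇ idm y) = f ◇ g.
Proof. by rewrite -tensm_comp comp_idl comp_idr. Qed.

Lemma tensm_swap (x x' y y' : C) (f : Hom x x') (g : Hom y y') :
  (idm x' ◇ g) ∘ (f ◇ idm y) = (f ◇ idm y') ∘ (idm x ◇ g).
Proof. by rewrite tensm_rl tensm_lr. Qed.

Lemma munit_faithl (x y : C) (f g : Hom x y) :
  idm 0 ◇ f = idm 0 ◇ g -> f = g.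
Proof.
move=> e; apply: (iso_epi (i := mlunit M x)).
by rewrite -!mlunit_nat e.
Qed.

Lemma munit_faithr (x y : C) (f g : Hom x y) :
  f ◇ idm 0 = g ◇ idm 0 -> f = g.
Proof.
move=> e; apply: (iso_epi (i := mrunit M x)).
by rewrite -!mrunit_nat e.
Qed.

(** Kelly's argument: tensoring with the unit object is faithful, and after
    tensoring on the left with it the equation is the pentagon on [0, 0, x, y]
    followed by the triangle. *)
Lemma mlunit_tens (x y : C) :
  (mlunit M x ◇ idm y) ∘ al 0 x y = mlunit M (x ⋄ y).
Proof.
apply: munit_faithl; apply: (iso_mono (i := al 0 x y)).
rewrite tensm_compr comp_assoc massoc_nat -(mtriangle M 0 x) tensm_compl.
rewrite -!comp_assoc [X in _ ∘ X]comp_assoc -mpentagon comp_assoc -massoc_nat.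
by rewrite tensm_id -comp_assoc mtriangle.
Qed.

(** The mirror image of [mlunit_tens], from the pentagon on [x, y, 0, 0]. *)
Lemma mrunit_tens (x y : C) :
  mrunit M (x ⋄ y) ∘ al x y 0 = idm x ◇ mrunit M y.
Proof.
apply: munit_faithr.
apply: (iso_epi (i := al x (y ⋄ 0) 0)).
apply: (iso_epi (i := iso_tens (iso_id x) (al y 0 0))).
rewrite /= tensm_compl -!comp_assoc [X in _ ∘ X]comp_assoc -mpentagon.
rewrite !comp_assoc mtriangle -tensm_id -!massoc_nat -!comp_assoc -tensm_compr.
by rewrite mtriangle.
Qed.

Lemma munit_lr : iso_mor (mlunit M 0) = mrunit M 0.
Proof.
apply: munit_faithr; apply: (iso_epi (i := al 0 0 0)).
rewrite mlunit_tens mtriangle; apply: (iso_mono (i := mlunit M 0)).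
by rewrite mlunit_nat.
Qed.

End MonoidalFacts.

(** * Moving one summand to the front *)

Section SymmetryFacts.
Variables (C : Category) (M : SymMonoidal C).
Local Notation "x ⋄ y" := (tens M x y) (at level 50, left associativity).
Local Notation "f ◇ g" := (tensm M f g) (at level 39, left associativity).
Local Notation "0" := (munit M).
Local Notation al := (massoc M).
Local Notation sy := (sm_sym M).

(** The compatibility of the symmetry with the units is a consequence of the
    hexagon on [0, 0, x], once the right unit has been moved past the associator
    by [mrunit_tens]. *)
Lemma mlunit_sym (x : C) : mrunit M x ∘ sy 0 x = mlunit M x.
Proof.
apply: (munit_faithl (M := M)); apply: (iso_mono (i := sy 0 x)).
rewrite tensm_compr -mrunit_tens -mtriangle !comp_assoc -mrunit_nat.
rewrite (reassoc3 (esym (msym_hexagon _ _ _ _))) !comp_assoc mrunit_tens.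
by rewrite -msym_nat.
Qed.

Definition cross (t a b : C) : Hom (t ⋄ (a ⋄ b)) (a ⋄ (t ⋄ b)) :=
  iso_inv (al a t b) ∘ ((sy t a ◇ idm b) ∘ al t a b).

Lemma massoc_inv_nat (x x' y y' z z' : C)
    (f : Hom x x') (g : Hom y y') (h : Hom z z') :
  iso_inv (al x' y' z') ∘ (f ◇ g ◇ h) = (f ◇ (g ◇ h)) ∘ iso_inv (al x y z).
Proof. by apply: iso_inv_swap; rewrite massoc_nat. Qed.

Lemma cross_nat (t t' a b b' : C) (f : Hom t t') (g : Hom b b') :
  cross t' a b' ∘ (f ◇ (idm a ◇ g)) = (idm a ◇ (f ◇ g)) ∘ cross t a b.
Proof.
rewrite /cross -!comp_assoc massoc_nat [in LHS](comp_assoc (_ ◇ idm _)).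
rewrite -tensm_comp comp_idl msym_nat -{1}[g]comp_idr tensm_comp !comp_assoc.
by rewrite massoc_inv_nat.
Qed.

(** The pentagon, arranged for moving the first summand [a] out of a nested
    bracket. *)
Lemma pentagon_inv (a b y z : C) :
  iso_inv (al a (b ⋄ y) z) ∘ (iso_inv (al a b y) ◇ idm z) ∘ al (a ⋄ b) y z
  = (idm a ◇ al b y z) ∘ iso_inv (al a b (y ⋄ z)).
Proof.
apply: (iso_epi (i := al a b (y ⋄ z))).
rewrite -[RHS]comp_assoc iso_invK comp_idr -comp_assoc mpentagon -!comp_assoc.
rewrite [X in _ ∘ X]comp_assoc -tensm_comp iso_invK comp_idl tensm_id.
by rewrite comp_idl comp_assoc iso_invK comp_idl.
Qed.

Lemma cross_massocm (t a b z : C) :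
  iso_inv (al a (t ⋄ b) z) ∘ (cross t a b ◇ idm z) ∘ al t (a ⋄ b) z
  = (idm a ◇ al t b z) ∘ cross t a (b ⋄ z) ∘ (idm t ◇ iso_inv (al a b z)).
Proof.
apply: (iso_epi (i := iso_tens M (iso_id t) (al a b z))) => /=.
rewrite -[RHS]comp_assoc -tensm_compr iso_invK tensm_id comp_idr.
rewrite /cross [RHS]comp_assoc -pentagon_inv !tensm_compl -!comp_assoc.
rewrite [X in _ ∘ (_ ∘ (_ ∘ X))]comp_assoc -mpentagon.
by rewrite [X in _ = _ ∘ (_ ∘ X)]comp_assoc -(tensm_id M b z) massoc_nat !comp_assoc.
Qed.

Lemma cross_massocr (t u a b : C) :
  cross (t ⋄ u) a b ∘ al t u (a ⋄ b)
  = (idm a ◇ al t u b) ∘ cross t a (u ⋄ b) ∘ (idm t ◇ cross u a b).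
Proof.
rewrite {2}/cross comp_assoc -pentagon_inv.
rewrite {1}/cross -!comp_assoc mpentagon !comp_assoc.
have hex : (sy (t ⋄ u) a ∘ al t u a)
    = iso_inv (al a t u) ∘ ((sy t a ◇ idm u) ∘ al t a u ∘ (idm t ◇ sy u a)).
  by rewrite -msym_hexagon !comp_assoc iso_invK comp_idl.
rewrite (reassoc2 (esym (tensm_compl _ _ _ _))) hex !tensm_compl !comp_assoc.
rewrite (reassoc2 (esym (massoc_nat _ _ _ _))) -(tensm_id M u b).
rewrite (reassoc2 (massoc_nat _ _ _ _)) !comp_assoc (reassoc2 (mpentagon _ _ _ _ _)).
rewrite !comp_assoc !(reassoc2 (esym (tensm_compr _ _ _ _))).
by rewrite /cross !comp_assoc iso_morK comp_idl.
Qed.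

Lemma cross_msym (y a b : C) :
  cross y a b ∘ sy (a ⋄ b) y = (idm a ◇ sy b y) ∘ iso_inv (al a b y).
Proof.
apply: (iso_epi (i := al a b y)).
rewrite -[RHS]comp_assoc iso_invK comp_idr /cross -!comp_assoc.
rewrite [X in _ ∘ (_ ∘ X)]comp_assoc msym_hexagon -!comp_assoc [X in _ ∘ X]comp_assoc -tensm_comp msym_invol.
by rewrite comp_idl tensm_id comp_idl comp_assoc iso_invK comp_idl.
Qed.

Lemma msym_cross (y a b : C) :
  iso_inv (al a b y) ∘ sy y (a ⋄ b) = (idm a ◇ sy y b) ∘ cross y a b.
Proof.
apply: (iso_epi (i := sy (a ⋄ b) y)).
rewrite -[LHS]comp_assoc -[RHS]comp_assoc cross_msym msym_invol comp_idr.
by rewrite comp_assoc -tensm_compr msym_invol tensm_id comp_idl.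
Qed.

Lemma cross_mlunit (a b : C) :
  (idm a ◇ mlunit M b) ∘ cross 0 a b = mlunit M (a ⋄ b).
Proof.
rewrite /cross -mtriangle -!comp_assoc [X in _ ∘ X]comp_assoc iso_morK comp_idl.
by rewrite comp_assoc -tensm_compl mlunit_sym mlunit_tens.
Qed.

(** A summand [a] is extracted from [t + u] by extracting it from [t] or from [u]
    and then rebracketing.  The lemmas from here to [pull_lunit] say that the
    extraction commutes with each structural isomorphism, for each possible
    position of [a]; they are the inductive steps of [pull_term]. *)
Lemma pull_tensl (t t' u u' a b b' : C) (f : Hom t (a ⋄ b)) (f' : Hom t' (a ⋄ b'))
    (p : Hom t t') (p' : Hom b b') (q : Hom u u') :
  f' ∘ p = (idm a ◇ p') ∘ f ->
  iso_inv (al a b' u') ∘ (f' ◇ idm u') ∘ (p ◇ q)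
  = (idm a ◇ (p' ◇ q)) ∘ (iso_inv (al a b u) ∘ (f ◇ idm u)).
Proof.
move=> e; rewrite comp_assoc -massoc_inv_nat -!comp_assoc -!tensm_comp e.
by rewrite comp_idl comp_idr.
Qed.

Lemma pull_tensr (t t' u u' a b b' : C) (f : Hom t (a ⋄ b)) (f' : Hom t' (a ⋄ b'))
    (p : Hom t t') (p' : Hom b b') (q : Hom u u') :
  f' ∘ p = (idm a ◇ p') ∘ f ->
  cross u' a b' ∘ (idm u' ◇ f') ∘ (q ◇ p)
  = (idm a ◇ (q ◇ p')) ∘ (cross u a b ∘ (idm u ◇ f)).
Proof.
move=> e; rewrite comp_assoc -cross_nat -!comp_assoc -!tensm_comp e.
by rewrite comp_idl comp_idr.
Qed.

Lemma pull_assocl (t u v a b : C) (f : Hom t (a ⋄ b)) :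
  iso_inv (al a (b ⋄ u) v) ∘ ((iso_inv (al a b u) ∘ (f ◇ idm u)) ◇ idm v)
    ∘ al t u v
  = (idm a ◇ al b u v) ∘ (iso_inv (al a b (u ⋄ v)) ∘ (f ◇ idm (u ⋄ v))).
Proof.
rewrite tensm_compl -[LHS]comp_assoc -[X in _ ∘ X]comp_assoc -massoc_nat.
by rewrite tensm_id !comp_assoc pentagon_inv.
Qed.

Lemma pull_assocm (t u v a b : C) (f : Hom u (a ⋄ b)) :
  iso_inv (al a (t ⋄ b) v) ∘ ((cross t a b ∘ (idm t ◇ f)) ◇ idm v) ∘ al t u v
  = (idm a ◇ al t b v)
    ∘ (cross t a (b ⋄ v) ∘ (idm t ◇ (iso_inv (al a b v) ∘ (f ◇ idm v)))).
Proof.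
rewrite tensm_compl -[LHS]comp_assoc -[X in _ ∘ X]comp_assoc -massoc_nat.
rewrite (comp_assoc _ (cross _ _ _ ◇ _)) [LHS]comp_assoc cross_massocm.
by rewrite -[LHS]comp_assoc -tensm_compr -[LHS]comp_assoc.
Qed.

Lemma pull_assocr (t u v a b : C) (f : Hom v (a ⋄ b)) :
  cross (t ⋄ u) a b ∘ (idm (t ⋄ u) ◇ f) ∘ al t u v
  = (idm a ◇ al t u b)
    ∘ (cross t a (u ⋄ b) ∘ (idm t ◇ (cross u a b ∘ (idm u ◇ f)))).
Proof.
rewrite -comp_assoc -tensm_id -massoc_nat [LHS]comp_assoc cross_massocr.
by rewrite -[LHS]comp_assoc -tensm_compr -[LHS]comp_assoc.
Qed.

Lemma pull_syml (t u a b : C) (f : Hom t (a ⋄ b)) :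
  cross u a b ∘ (idm u ◇ f) ∘ sy t u
  = (idm a ◇ sy b u) ∘ (iso_inv (al a b u) ∘ (f ◇ idm u)).
Proof. by rewrite -comp_assoc -msym_nat !comp_assoc cross_msym. Qed.

Lemma pull_symr (t u a b : C) (f : Hom u (a ⋄ b)) :
  iso_inv (al a b t) ∘ (f ◇ idm t) ∘ sy t u
  = (idm a ◇ sy t b) ∘ (cross t a b ∘ (idm t ◇ f)).
Proof. by rewrite -comp_assoc -msym_nat comp_assoc msym_cross -[LHS]comp_assoc. Qed.

Lemma pull_lunit (t a b : C) (f : Hom t (a ⋄ b)) :
  f ∘ mlunit M t = (idm a ◇ mlunit M b) ∘ (cross 0 a b ∘ (idm 0 ◇ f)).
Proof. by rewrite comp_assoc cross_mlunit mlunit_nat. Qed.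

Lemma merge_unit_assoc (x y z : C) (f : Hom x 0) (g : Hom y 0) (h : Hom z 0) :
  mlunit M 0 ∘ ((mlunit M 0 ∘ (f ◇ g)) ◇ h) ∘ al x y z
  = mlunit M 0 ∘ (f ◇ (mlunit M 0 ∘ (g ◇ h))).
Proof.
rewrite -{1}[h]comp_idl -{2}[f]comp_idl !tensm_comp -!comp_assoc -massoc_nat.
by rewrite munit_lr (comp_assoc (_ ◇ idm 0)) mtriangle munit_lr.
Qed.

Lemma merge_unit_sym (x y : C) (f : Hom x 0) (g : Hom y 0) :
  mlunit M 0 ∘ (g ◇ f) ∘ sy x y = mlunit M 0 ∘ (f ◇ g).
Proof.
by rewrite -comp_assoc -msym_nat comp_assoc munit_lr mlunit_sym munit_lr.
Qed.

End SymmetryFacts.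

(** * Coherence for structural isomorphisms *)

Inductive tree := Leaf | Null | Plus of tree & tree.

Inductive term : tree -> tree -> Type :=
| Tid t : term t t
| Tcomp t u v : term u v -> term t u -> term t v
| Tinv t u : term t u -> term u t
| Tplus t t' u u' : term t t' -> term u u' -> term (Plus t u) (Plus t' u')
| Tassoc t u v : term (Plus t (Plus u v)) (Plus (Plus t u) v)
| Tsym t u : term (Plus t u) (Plus u t)
| Tlunit t : term (Plus Null t) t.

Section Interpretation.
Variables (C : Category) (M : SymMonoidal C) (a : C).

Fixpoint interp (t : tree) : C :=
  match t with
  | Leaf => a
  | Null => munit M
  | Plus t u => tens M (interp t) (interp u)
  end.

Fixpoint ev t u (p : term t u) : Iso (interp t) (interp u) :=
  match p with
  | Tid t => iso_id (interp t)
  | Tcomp t u v q p => iso_comp (ev q) (ev p)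
  | Tinv t u p => iso_sym (ev p)
  | Tplus t t' u u' p q => iso_tens M (ev p) (ev q)
  | Tassoc t u v => massoc M (interp t) (interp u) (interp v)
  | Tsym t u => sm_sym M (interp t) (interp u)
  | Tlunit t => mlunit M (interp t)
  end.
End Interpretation.

(** The set of leaves of a tree is its value in finite sets, the label being the
    point; hence every statement about all symmetric monoidal categories also
    speaks about leaves. *)
Definition pts (t : tree) : finType := interp FSet_add (unit : finType) t.
Definition tbij t u (p : term t u) : bij (pts t) (pts u) :=
  iso_mor (ev FSet_add (unit : finType) p).

(** A removed leaf is replaced by [Null], so that the shape of the remaining tree,
    and with it every structural isomorphism, survives the removal. *)
Fixpoint del (t : tree) : pts t -> tree :=
  match t with
  | Leaf => fun _ => Null
  | Null => fun _ => Null
  | Plus t u => fun x : (pts t + pts u)%type =>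
      match x with inl y => Plus (del y) u | inr z => Plus t (del z) end
  end.

Definition Trunit t : term (Plus t Null) t := Tcomp (Tlunit t) (Tsym t Null).

Definition Tcross (t b : tree) : term (Plus t (Plus Leaf b)) (Plus Leaf (Plus t b)) :=
  Tcomp (Tinv (Tassoc Leaf t b))
    (Tcomp (Tplus (Tsym t Leaf) (Tid b)) (Tassoc t Leaf b)).

Fixpoint pull (t : tree) : forall x : pts t, term t (Plus Leaf (del x)) :=
  match t with
  | Leaf => fun _ => Tinv (Trunit Leaf)
  | Null => fun x => match (x : void) with end
  | Plus t u => fun x : (pts t + pts u)%type =>
      match x with
      | inl y => Tcomp (Tinv (Tassoc Leaf (del y) u)) (Tplus (pull y) (Tid u))
      | inr z => Tcomp (Tcross t (del z)) (Tplus (Tid t) (pull z))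
      end
  end.

Lemma tbijK t u (p : term t u) : cancel (tbij p) (tbij (Tinv p)).
Proof.
move=> x; exact: (congr1 (fun f : bij (pts t) (pts t) => f x)
  (iso_invK (ev FSet_add (unit : finType) p))).
Qed.

Lemma tbij_invK t u (p : term t u) : cancel (tbij (Tinv p)) (tbij p).
Proof.
move=> x; exact: (congr1 (fun f : bij (pts u) (pts u) => f x)
  (iso_morK (ev FSet_add (unit : finType) p))).
Qed.

(** Removing corresponding leaves from the source and the target of a term leaves
    a term.  That this smaller term is chosen before the category matters: in
    finite sets the same equation determines the bijection which it induces. *)
Lemma pull_term t u (p : term t u) (x : pts t) (y : pts u) :
  tbij p x = y -> exists p' : term (del x) (del y),
  forall (C : Category) (M : SymMonoidal C) (a : C),
    ev M a (pull y) ∘ ev M a p = tensm M (idm a) (ev M a p') ∘ ev M a (pull x).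
Proof.
elim: p x y => {t u}
  [t|t u v q IHq p IHp|t u p IHp|t t' u u' p IHp q IHq|t u v|t u|t] x y.
- move=> <-; exists (Tid _) => C M a /=.
  by rewrite tensm_id comp_idr comp_idl.
- move=> e; have [q' Hq] := IHq (tbij p x) y e.
  have [p' Hp] := IHp x _ erefl; exists (Tcomp q' p') => C M a /=.
  by rewrite comp_assoc Hq -comp_assoc Hp comp_assoc -tensm_compr.
- move=> e; have [|p' Hp] := IHp y x; first by rewrite -e tbij_invK.
  exists (Tinv p') => C M a /=.
  exact: esym (iso_inv_swap (j := iso_tens M (iso_id a) (ev M a p'))
    (esym (Hp C M a))).
- case: x => x <-.
  + have [p' Hp] := IHp x _ erefl; exists (Tplus p' q) => C M a.
    exact: (pull_tensl (ev M a q) (Hp C M a)).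
  + have [q' Hq] := IHq x _ erefl; exists (Tplus p q') => C M a.
    exact: (pull_tensr (ev M a p) (Hq C M a)).
- case: x => [x|[x|x]] <-.
  + by exists (Tassoc (del x) u v) => C M a; exact: pull_assocl.
  + by exists (Tassoc t (del x) v) => C M a; exact: pull_assocm.
  + by exists (Tassoc t u (del x)) => C M a; exact: pull_assocr.
- case: x => x <-.
  + by exists (Tsym (del x) u) => C M a; exact: pull_syml.
  + by exists (Tsym t (del x)) => C M a; exact: pull_symr.
- by case: x => [[]|x] <-; exists (Tlunit (del x)) => C M a; exact: pull_lunit.
Qed.

Fixpoint leaves (t : tree) : nat :=
  match t with Leaf => 1 | Null => 0 | Plus t u => leaves t + leaves u end.

Lemma leaves_del t (x : pts t) : (leaves (del x)).+1 = leaves t.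
Proof.
elim: t x => [|[]|t IHt u IHu [x|x]] //=.
  by rewrite -(IHt x).
by rewrite -(IHu x) addnS.
Qed.

Fixpoint collapse (t : tree) : (pts t -> False) -> term t Null :=
  match t with
  | Leaf => fun h => match h tt with end
  | Null => fun _ => Tid Null
  | Plus t u => fun h =>
      Tcomp (Tlunit Null)
        (Tplus (collapse (fun x : pts t => h (inl x)))
               (collapse (fun y : pts u => h (inr y))))
  end.

(** Between trees without leaves two terms agree, because they become the same map
    once the target has been collapsed to [Null]. *)
Lemma collapse_term t u (p : term t u) (ht : pts t -> False) (hu : pts u -> False)
    (C : Category) (M : SymMonoidal C) (a : C) :
  ev M a (collapse hu) ∘ ev M a p = ev M a (collapse ht).
Proof.
have void_uniq t' (h h' : pts t' -> False) : h = h'.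
  exact: proof_irrelevance.
elim: p ht hu => {t u}
  [t|t u v q IHq p IHp|t u p IHp|t t' u u' p IHp q IHq|t u v|t u|t] ht hv.
- by rewrite /= comp_idr (void_uniq _ ht hv).
- have hu : pts u -> False by move=> x; exact: hv (tbij q x).
  by rewrite /= comp_assoc (IHq hu) IHp.
- by rewrite -(IHp hv ht) /= -comp_assoc iso_morK comp_idr.
- by rewrite /= -comp_assoc -tensm_comp; congr (_ ∘ tensm _ _ _).
- rewrite (void_uniq _ hv (fun x => ht (tbij (Tinv (Tassoc t u v)) x))).
  exact: merge_unit_assoc.
- rewrite (void_uniq _ hv (fun x => ht (tbij (Tinv (Tsym t u)) x))).
  exact: merge_unit_sym.
- rewrite (void_uniq _ hv (fun x => ht (tbij (Tinv (Tlunit t)) x))).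
  exact: esym (mlunit_nat _ _).
Qed.

(** Induction on the number of leaves.  Extracting a leaf [x] from the source and
    its common image from the target is invertible, and by [pull_term] reduces
    the equality to the two terms with this leaf removed.  These induce the same
    bijection: the equations of [pull_term], read in finite sets, express both
    bijections by that of [p] and [q]. *)
Theorem term_coherence t u (p q : term t u) : tbij p =1 tbij q ->
  forall (C : Category) (M : SymMonoidal C) (a : C),
    iso_mor (ev M a p) = ev M a q.
Proof.
elim: {t}_.+1 {-2}t (ltnSn (leaves t)) u p q => // n IH t tn u p q pq C M a.
have [x _|t0] := pickP (xpredT : pred (pts t)); last first.
  have ht : pts t -> False by move=> x; have := t0 x.
  have hu : pts u -> False by move=> y; exact: ht (tbij (Tinv p) y).
  apply: (iso_mono (i := ev M a (collapse hu))).
  by rewrite !(collapse_term _ ht hu).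
have [p' Hp] := pull_term (erefl (tbij p x)).
have [q' Hq] := pull_term (esym (pq x)).
apply: (iso_mono (i := ev M a (pull (tbij p x)))); rewrite Hp Hq.
congr (tensm _ _ _ ∘ _); apply: IH; first by rewrite leaves_del.
pose E v w (r : term v w) := iso_mor (ev FSet_add (unit : finType) r).
pose pt : FSet_cat := (unit : finType).
have e : tensm FSet_add (idm pt) (E _ _ p') = tensm FSet_add (idm pt) (E _ _ q').
  have := Hq _ FSet_add pt; have <- : iso_mor (ev FSet_add pt p) = ev FSet_add pt q.
    exact: bij_ext.
  by rewrite Hp => /iso_epi.
move=> z; have := congr1 (fun f : bij (unit + pts _) (unit + pts _) => f (inr z)) e.
by move=> [].
Qed.

(** * Every bijection of leaves is structural *)

Fixpoint std (n : nat) : tree :=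
  match n with 0 => Null | n'.+1 => Plus Leaf (std n') end.

Fixpoint std_add (n m : nat) : term (Plus (std n) (std m)) (std (n + m)) :=
  match n with
  | 0 => Tlunit (std m)
  | n'.+1 => Tcomp (Tplus (Tid Leaf) (std_add n' m))
                   (Tinv (Tassoc Leaf (std n') (std m)))
  end.

Fixpoint normalize (t : tree) : term t (std (leaves t)) :=
  match t with
  | Leaf => Tinv (Trunit Leaf)
  | Null => Tid Null
  | Plus t u => Tcomp (std_add (leaves t) (leaves u))
                      (Tplus (normalize t) (normalize u))
  end.

(** The leaf is carried to the front by successive exchanges of neighbours. *)
Lemma term_to_front n (x : pts (std n.+1)) :
  {p : term (std n.+1) (std n.+1) | tbij p x = inl tt}.
Proof.
elim: n x => [|n IH] [[]|x]; try by exists (Tid _).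
have [p px] := IH x; exists (Tcomp (Tcross Leaf (std n)) (Tplus (Tid Leaf) p)).
by rewrite /tbij /= -[bij_fun _ x]/(tbij p x) px.
Qed.

Section BijInr.
Variables (A B : Type) (f : bij (unit + A) (unit + B)).
Hypothesis f0 : f (inl tt) = inl tt.

Lemma bij_inr_sub (x : A) : {y : B | f (inr x) = inr y}.
Proof.
case e : (f (inr x)) => [[]|y]; last by exists y.
by have := bij_funK f (inr x); rewrite e -f0 bij_funK.
Qed.

End BijInr.

Lemma bij_inr (A B : Type) (f : bij (unit + A) (unit + B)) :
  f (inl tt) = inl tt -> {g : bij A B | forall x, f (inr x) = inr (g x)}.
Proof.
move=> f0; have f'0 : bij_sym f (inl tt) = inl tt by rewrite -[in LHS]f0 /= bij_funK.
unshelve eexists.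
  exists (fun x => sval (bij_inr_sub f0 x)) (fun y => sval (bij_inr_sub f'0 y)).
  - move=> x; case: (bij_inr_sub f0 x) => y /= e; case: (bij_inr_sub f'0 y) => z /= e'.
    by rewrite -e bij_funK in e'; case: e'.
  - move=> x; case: (bij_inr_sub f'0 x) => y /= e; case: (bij_inr_sub f0 y) => z /= e'.
    by rewrite -e bij_invK in e'; case: e'.
by move=> x /=; case: (bij_inr_sub f0 x).
Qed.

(** Composing with a term that carries the image of the first leaf back to the
    front leaves a bijection of the remaining leaves. *)
Lemma full_std n (f : bij (pts (std n)) (pts (std n))) :
  {p : term (std n) (std n) | tbij p =1 f}.
Proof.
elim: n f => [|n IH] f; first by exists (Tid _) => - [].
have [r rf] := term_to_front (f (inl tt)).
have [|g Hg] := @bij_inr _ _ (bij_comp (tbij r) f); first exact: rf.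
have [p pg] := IH g; exists (Tcomp (Tinv r) (Tplus (Tid Leaf) p)) => x.
apply: (can_inj (bij_funK (tbij r))).
rewrite -[RHS]/(bij_comp (tbij r) f x).
rewrite -[tbij (Tcomp _ _) x]/(tbij (Tinv r) (tbij (Tplus (Tid Leaf) p) x)) tbij_invK.
case: x => [[]|x]; first exact: esym rf.
by rewrite Hg -pg.
Qed.

Lemma leaves_pts t : #|pts t| = leaves t.
Proof.
elim: t => [||t IHt u IHu]; [exact: card_unit | exact: card_void |].
by rewrite [LHS]card_sum IHt IHu.
Qed.

Lemma bij_card (S T : finType) : bij S T -> #|S| = #|T|.
Proof.
move=> f; apply: (@bij_eq_card _ _ f).
by exists (bij_inv f); [exact: bij_funK | exact: bij_invK].
Qed.

Theorem term_full t u (f : bij (pts t) (pts u)) :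
  {p : term t u | tbij p =1 f}.
Proof.
have e : leaves t = leaves u by rewrite -!leaves_pts; exact: bij_card f.
move: (normalize t) (normalize u); rewrite -e => nt nu.
have [p Hp] := full_std (bij_comp (tbij nu) (bij_comp f (tbij (Tinv nt)))).
exists (Tcomp (Tinv nu) (Tcomp p nt)) => x.
apply: (can_inj (bij_funK (tbij nu))).
rewrite [LHS](tbij_invK nu (tbij p (tbij nt x))) Hp /=.
by congr (tbij nu (f _)); exact: tbijK.
Qed.

(** * The symmetric monoidal functor generated by an object *)

Program Definition bij_of_card (S T : finType) (e : #|S| = #|T|) : bij S T :=
  @Bij S T (fun x => enum_val (cast_ord e (enum_rank x)))
    (fun y => enum_val (cast_ord (esym e) (enum_rank y))) _ _.
Next Obligation. by move=> S T e x; rewrite enum_valK cast_ordK enum_rankK. Qed.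
Next Obligation. by move=> S T e x; rewrite enum_valK cast_ordKV enum_rankK. Qed.

Lemma leaves_std n : leaves (std n) = n.
Proof. by elim: n => //= n ->. Qed.

Definition tree_of (X : finType) : tree := std #|X|.

(** Only its being a bijection matters, so the enumeration is kept opaque. *)
Lemma enc (X : finType) : bij X (pts (tree_of X)).
Proof. by apply: bij_of_card; rewrite leaves_pts leaves_std. Qed.

Lemma finType_ind (P : finType -> Prop) :
  (forall X Y : finType, bij X Y -> P X -> P Y) ->
  P (void : finType) -> P (unit : finType) ->
  (forall X Y : finType, P X -> P Y -> P (X + Y)%type) -> forall X, P X.
Proof.
move=> Piso P0 P1 PD X; apply: (Piso _ _ (bij_sym (enc X))).
elim: (tree_of X) => [||t Pt u Pu]; [exact: P1 | exact: P0 | exact: PD].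
Qed.

Section FreeFunctor.
Variables (C : Category) (M : SymMonoidal C) (a : C).

(** By [term_coherence] the value does not depend on the term which represents the
    bijection, so [lift] is functorial and compatible with all the structure.
    Consequently an equation between composites of lifts holds as soon as the
    underlying bijections agree. *)
Definition lift t u (f : bij (pts t) (pts u)) : Iso (interp M a t) (interp M a u) :=
  ev M a (sval (term_full f)).

Lemma lift_ev t u (p : term t u) (f : bij (pts t) (pts u)) :
  tbij p =1 f -> iso_mor (ev M a p) = lift f.
Proof.
move=> pf; apply: term_coherence => x.
by rewrite (svalP (term_full f)) pf.
Qed.

Lemma lift_id t : idm (interp M a t) = lift (bij_id (pts t)).
Proof. by rewrite -(lift_ev (p := Tid t)). Qed.

Lemma lift_comp t u v (g : bij (pts u) (pts v)) (f : bij (pts t) (pts u)) :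
  lift g ∘ lift f = lift (bij_comp g f).
Proof.
rewrite -(lift_ev (p := Tcomp (sval (term_full g)) (sval (term_full f)))) //.
by move=> x; rewrite -[RHS]/(g (f x)) -(svalP (term_full g)) -(svalP (term_full f)).
Qed.

Lemma lift_plus t t' u u' (f : bij (pts t) (pts t')) (g : bij (pts u) (pts u')) :
  tensm M (lift f) (lift g)
  = lift (t := Plus t u) (u := Plus t' u') (bij_sum f g).
Proof.
rewrite -(lift_ev (p := Tplus (sval (term_full f)) (sval (term_full g)))) //.
by case=> x; rewrite [RHS]/= -?(svalP (term_full f)) -?(svalP (term_full g)).
Qed.

Lemma lift_assoc t u v :
  iso_mor (massoc M (interp M a t) (interp M a u) (interp M a v))
  = lift (t := Plus t (Plus u v)) (u := Plus (Plus t u) v)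
      (bij_sumA (pts t) (pts u) (pts v)).
Proof. by rewrite -(lift_ev (p := Tassoc t u v)). Qed.

Lemma lift_sym t u :
  iso_mor (sm_sym M (interp M a t) (interp M a u))
  = lift (t := Plus t u) (u := Plus u t) (bij_sumC (pts t) (pts u)).
Proof. by rewrite -(lift_ev (p := Tsym t u)). Qed.

Lemma lift_lunit t :
  iso_mor (mlunit M (interp M a t)) = lift (t := Plus Null t) (bij_sum0l (pts t)).
Proof. by rewrite -(lift_ev (p := Tlunit t)). Qed.

Lemma lift_runit t :
  iso_mor (mrunit M (interp M a t)) = lift (t := Plus t Null) (bij_sum0r (pts t)).
Proof.
rewrite -(lift_ev (p := Trunit t)) /=; last by case=> [x|[]].
by rewrite -mlunit_sym -comp_assoc msym_invol comp_idr.
Qed.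

Definition free_obj (X : FSet_cat) : C := interp M a (tree_of X).

Definition recode (X Y : finType) (f : bij X Y) :
    bij (pts (tree_of X)) (pts (tree_of Y)) :=
  bij_comp (enc Y) (bij_comp f (bij_sym (enc X))).

Program Definition free_fun : Functor FSet_cat C :=
  {| fobj := free_obj;
     fmap := fun (X Y : finType) (f : bij X Y) => iso_mor (lift (recode f)) |}.
Next Obligation.
move=> X; rewrite lift_id; congr (iso_mor (lift _)); apply: bij_ext => x.
by rewrite /= bij_invK.
Qed.
Next Obligation.
move=> X Y Z g f; rewrite lift_comp; congr (iso_mor (lift _)); apply: bij_ext => x.
by rewrite /= bij_funK.
Qed.

Definition free_tens (X Y : finType) :
    Iso (free_obj (X + Y)%type) (tens M (free_obj X) (free_obj Y)) :=
  lift (u := Plus (tree_of X) (tree_of Y))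
    (bij_comp (bij_sum (enc X) (enc Y)) (bij_sym (enc (X + Y)%type))).

Definition free_unit : Iso (free_obj (void : finType)) (munit M) :=
  lift (u := Null) (bij_sym (enc void)).

Definition free_one : Iso (free_obj (unit : finType)) a :=
  lift (u := Leaf) (bij_sym (enc unit)).

(* [lift_plus] and [lift_comp] only apply when sums of interpretations are
   presented as interpretations of sums. *)
Ltac fold_interp :=
  repeat match goal with |- context [tens (sm_mon M) (interp M a ?t) (interp M a ?u)] =>
    change (tens (sm_mon M) (interp M a t) (interp M a u)) with (interp M a (Plus t u))
  end.

Ltac lift_law :=
  intros; rewrite /free_tens /free_unit /= /free_obj;
  rewrite ?lift_id ?lift_assoc ?lift_sym ?lift_lunit ?lift_runit;
  change (munit M) with (interp M a Null);
  fold_interp; rewrite ?lift_plus; fold_interp; rewrite ?lift_plus; fold_interp;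
  rewrite ?lift_comp;
  congr (iso_mor (lift _)); apply: bij_ext.

Program Definition free_monoidal : MonoidalFunctor free_fun FSet_add M :=
  {| mf_tens := free_tens; mf_unit := free_unit |}.
Next Obligation.
lift_law => z /=; rewrite !bij_funK.
by case: (bij_inv _ z) => w /=; rewrite bij_funK.
Qed.
Next Obligation.
lift_law => w /=; rewrite !bij_funK.
by case: (bij_inv _ w) => [v|[v|v]] /=; rewrite !bij_funK.
Qed.
Next Obligation.
by lift_law => z /=; case: (bij_inv _ z) => [[]|w].
Qed.
Next Obligation.
by lift_law => z /=; case: (bij_inv _ z) => [w|[]].
Qed.

Lemma free_symmetric : symmetric_monoidal_functor free_monoidal.
Proof.
rewrite /symmetric_monoidal_functor.
by lift_law => z /=; rewrite !bij_funK; case: (bij_inv _ z).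
Qed.

End FreeFunctor.

(** * Extending isomorphisms to monoidal transformations *)

Section Canonical.
Variables (C : Category) (M : SymMonoidal C) (F : Functor FSet_cat C).
Variable phi : MonoidalFunctor F FSet_add M.
Hypothesis phi_sym : symmetric_monoidal_functor (M := FSet_add) phi.

(** A monoidal functor sends a set of leaves to the corresponding sum of copies of
    its value at the point; [canon_nat] says that on bijections coming from terms
    it is then given by evaluation. *)
Fixpoint canon (t : tree) : Iso (F (pts t)) (interp M (F (unit : finType)) t) :=
  match t with
  | Leaf => iso_id (F (unit : finType))
  | Null => mf_unit phi
  | Plus t u => iso_comp (iso_tens M (canon t) (canon u)) (mf_tens phi (pts t) (pts u))
  end.

Lemma canon_nat t u (p : term t u) :
  ev M _ p ∘ canon t = canon u ∘ fmap F (x := pts t) (y := pts u) (tbij p).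
Proof.
elim: p => {t u}
  [t|t u v q IHq p IHp|t u p IHp|t t' u u' p IHp q IHq|t u v|t u|t].
- rewrite /= comp_idl -[RHS]/(_ ∘ fmap F (idm (pts t : FSet_cat))).
  by rewrite fmap_id comp_idr.
- rewrite -[tbij _]/((tbij q : @Hom FSet_cat _ _) ∘ (tbij p : @Hom FSet_cat _ _)).
  by rewrite fmap_comp /= -comp_assoc IHp comp_assoc IHq comp_assoc.
- exact: (iso_inv_swap (i := fmap_iso F (ev FSet_add (unit : finType) p)) IHp).
- rewrite [LHS]comp_assoc -tensm_comp IHp IHq tensm_comp -[LHS]comp_assoc.
  by rewrite -mf_tens_nat comp_assoc.
- have split_r (x y z w v' : C) (f : Hom x y) (g : Hom w v') (h : Hom z w) :
      tensm M f (g ∘ h) = tensm M f g ∘ tensm M (idm x) h.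
    by rewrite -tensm_comp comp_idr.
  have split_l (x y z w v' : C) (f : Hom x y) (g : Hom w v') (h : Hom z w) :
      tensm M (g ∘ h) f = tensm M g f ∘ tensm M h (idm x).
    by rewrite -tensm_comp comp_idr.
  rewrite /= split_r split_l !comp_assoc massoc_nat -!comp_assoc.
  congr (_ ∘ _); rewrite !comp_assoc; exact: esym (mf_assoc phi _ _ _).
- by rewrite /= comp_assoc msym_nat -!comp_assoc phi_sym.
- rewrite -[RHS]/(canon t ∘ fmap F (mlunit FSet_add (pts t))) -(mf_lunit phi).
  by rewrite !comp_assoc -mlunit_nat -[in RHS](comp_assoc (mlunit M _)) tensm_rl.
Qed.

End Canonical.

Section MapInterp.
Variables (C : Category) (M : SymMonoidal C) (a b : C) (f : Iso a b).

Fixpoint interp_map (t : tree) : Iso (interp M a t) (interp M b t) :=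
  match t with
  | Leaf => f
  | Null => iso_id (munit M)
  | Plus t u => iso_tens M (interp_map t) (interp_map u)
  end.

Lemma interp_map_nat t u (p : term t u) :
  ev M b p ∘ interp_map t = interp_map u ∘ ev M a p.
Proof.
elim: p => {t u}
  [t|t u v q IHq p IHp|t u p IHp|t t' u u' p IHp q IHq|t u v|t u|t] /=.
- by rewrite comp_idl comp_idr.
- by rewrite -comp_assoc IHp !comp_assoc IHq.
- exact: iso_inv_swap IHp.
- by rewrite -!tensm_comp IHp IHq.
- exact: massoc_nat.
- exact: msym_nat.
- exact: mlunit_nat.
Qed.

End MapInterp.

Section Extension.
Variables (C : Category) (M : SymMonoidal C) (F G : Functor FSet_cat C).
Variables (phi : MonoidalFunctor F FSet_add M) (psi : MonoidalFunctor G FSet_add M).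
Hypothesis phi_sym : symmetric_monoidal_functor (M := FSet_add) phi.
Hypothesis psi_sym : symmetric_monoidal_functor (M := FSet_add) psi.
Variable f : Iso (F (unit : finType)) (G (unit : finType)).

Definition extend_tree (t : tree) : Iso (F (pts t)) (G (pts t)) :=
  iso_comp (iso_sym (canon psi t)) (iso_comp (interp_map M f t) (canon phi t)).

(** The transformation is natural for terms by construction, hence for all
    bijections by [term_full]. *)
Lemma extend_tree_nat t u (e : bij (pts t) (pts u)) :
  extend_tree u ∘ fmap F (x := pts t) (y := pts u) e
  = fmap G (x := pts t) (y := pts u) e ∘ extend_tree t.
Proof.
have [p pe] := term_full e; have -> : e = tbij p by apply: bij_ext => x.
apply: (iso_mono (i := canon psi u)); rewrite /= !comp_assoc iso_morK comp_idl.
rewrite -[LHS]comp_assoc -canon_nat // comp_assoc -interp_map_nat -!comp_assoc.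
rewrite [in RHS]comp_assoc -canon_nat // -!comp_assoc.
by rewrite [X in _ = _ ∘ X]comp_assoc iso_morK comp_idl.
Qed.

Lemma extend_tree_plus t u :
  mf_tens psi (pts t) (pts u) ∘ extend_tree (Plus t u)
  = tensm M (extend_tree t) (extend_tree u) ∘ mf_tens phi (pts t) (pts u).
Proof.
by rewrite /= !comp_assoc iso_morK comp_idl !tensm_comp.
Qed.

Definition extend (X : finType) : Iso (F X) (G X) :=
  iso_comp (fmap_iso G (iso_sym (FSet_iso (enc X))))
    (iso_comp (extend_tree (tree_of X)) (fmap_iso F (FSet_iso (enc X)))).

(** The enumeration in the definition of [extend] may be replaced by a bijection
    with the leaves of any tree.  Choosing this tree as a sum, a leaf or [Null]
    gives the compatibilities with sums, with the point and with zero. *)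
Lemma extendE (X : finType) t (e : bij X (pts t)) :
  fmap G (x := X) (y := pts t) e ∘ extend X
  = extend_tree t ∘ fmap F (x := X) (y := pts t) e.
Proof.
have [e' ->] : exists e', e = (e' : @Hom FSet_cat (pts (tree_of X)) (pts t))
                             ∘ (enc X : @Hom FSet_cat X _).
  exists (bij_comp e (bij_sym (enc X))).
  by apply: bij_ext => x /=; rewrite bij_funK.
rewrite !fmap_comp [RHS]comp_assoc extend_tree_nat -[LHS]comp_assoc -[RHS]comp_assoc.
congr (_ ∘ _); rewrite [LHS]comp_assoc (iso_morK (fmap_iso G (FSet_iso (enc X)))).
by rewrite comp_idl.
Qed.

Lemma extend_nat (X Y : finType) (s : bij X Y) :
  extend Y ∘ fmap F (x := X) (y := Y) s = fmap G (x := X) (y := Y) s ∘ extend X.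
Proof.
apply: (iso_mono (i := fmap_iso G (FSet_iso (enc Y)))) => /=.
rewrite [LHS]comp_assoc extendE [RHS]comp_assoc -[LHS]comp_assoc -!fmap_comp.
exact: esym (extendE (bij_comp (enc Y) s)).
Qed.

Lemma extend_unit : iso_mor (extend unit) = f.
Proof.
have := extendE (t := Leaf) (bij_id unit).
rewrite -![fmap _ _]/(fmap _ (idm (unit : FSet_cat))) !fmap_id comp_idl comp_idr => ->.
by rewrite /= comp_idl comp_idr.
Qed.

Lemma extend_zero : mf_unit psi ∘ extend void = mf_unit phi.
Proof.
have := extendE (t := Null) (bij_id void).
rewrite -![fmap _ _]/(fmap _ (idm (void : FSet_cat))) !fmap_id comp_idl comp_idr => ->.
by rewrite /= comp_idl comp_assoc iso_morK comp_idl.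
Qed.

Lemma extend_add (X Y : finType) :
  mf_tens psi X Y ∘ extend (X + Y)%type = tensm M (extend X) (extend Y) ∘ mf_tens phi X Y.
Proof.
apply: (iso_mono (i := iso_tens M (fmap_iso G (FSet_iso (enc X)))
                                  (fmap_iso G (FSet_iso (enc Y))))) => /=.
rewrite [RHS]comp_assoc -tensm_comp !extendE [LHS]comp_assoc -(mf_tens_nat psi).
rewrite -[LHS]comp_assoc (extendE (t := Plus _ _) (bij_sum (enc X) (enc Y))).
rewrite [LHS]comp_assoc extend_tree_plus -[LHS]comp_assoc (mf_tens_nat phi).
by rewrite [LHS]comp_assoc -tensm_comp.
Qed.

End Extension.

Lemma monoidal_transformation_uniq (C : Category) (M : Monoidal C)
    (F G : Functor FSet_cat C)
    (phi : MonoidalFunctor F FSet_add M) (psi : MonoidalFunctor G FSet_add M)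
    (s t : NatTrans F G) :
  monoidal_transformation phi psi s -> monoidal_transformation phi psi t ->
  s (unit : finType) = t (unit : finType) -> forall X, s X = t X.
Proof.
move=> [s2 s0] [t2 t0] st; apply: finType_ind => [X Y e eX||//|X Y eX eY].
- apply: (iso_epi (i := fmap_iso F (FSet_iso e))).
  by rewrite /= !nt_nat eX.
- by apply: (iso_mono (i := mf_unit psi)); rewrite s0 t0.
- by apply: (iso_mono (i := mf_tens psi X Y)); rewrite s2 t2 eX eY.
Qed.

(** * From additive to multiplicative structure *)

(** Up to isomorphism all objects are sums of copies of [1], expressed as the
    induction principle through which this is used. *)
Definition generated_by_one (R : RigCategory) : Prop :=
  forall P : R -> Prop,
  (forall x y : R, Iso x y -> P x -> P y) -> P (zero R) -> P (one R) ->
  (forall x y : R, P x -> P y -> P (x ⊕ y)) -> forall x, P x.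

Lemma interchangeE (C : Category) (M : SymMonoidal C) (p q s u : C) :
  interchange M p q s u
  = iso_inv (massoc M (tens M p s) q u)
    ∘ tensm M (massoc M p s q ∘ tensm M (idm p) (sm_sym M q s)
               ∘ iso_inv (massoc M p q s)) (idm u)
    ∘ massoc M (tens M p q) s u.
Proof. by rewrite /interchange !tensm_compl !comp_assoc. Qed.

Section Interchange.
Variables (C D : Category) (M : SymMonoidal C) (N : SymMonoidal D).

Lemma interchange_nat (p p' q q' s s' u u' : C) (f : Hom p p') (g : Hom q q')
    (h : Hom s s') (k : Hom u u') :
  interchange M p' q' s' u' ∘ tensm M (tensm M f g) (tensm M h k)
  = tensm M (tensm M f h) (tensm M g k) ∘ interchange M p q s u.
Proof.
have slide (x y x' y' : C) (v : Hom x' y') (v' : Hom x y) (m : Hom x x') (m' : Hom y y') :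
    v ∘ m = m' ∘ v' -> tensm M v (idm u') ∘ tensm M m k = tensm M m' k ∘ tensm M v' (idm u).
  by move=> e; rewrite -!tensm_comp e comp_idl comp_idr.
rewrite /interchange -comp_assoc massoc_nat comp_assoc.
rewrite (reassoc2 (slide _ _ _ _ _ _ _ _ (massoc_inv_nat _ _ _ _))) comp_assoc.
have sw : tensm M (idm p') (sm_sym M q' s') ∘ tensm M f (tensm M g h)
    = tensm M f (tensm M h g) ∘ tensm M (idm p) (sm_sym M q s).
  by rewrite -!tensm_comp comp_idl comp_idr msym_nat.
rewrite (reassoc2 (slide _ _ _ _ _ _ _ _ sw)) comp_assoc.
rewrite (reassoc2 (slide _ _ _ _ _ _ _ _ (massoc_nat _ _ _ _))) comp_assoc.
by rewrite massoc_inv_nat !comp_assoc.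
Qed.

Variables (F : Functor C D) (phi : MonoidalFunctor F M N).
Hypothesis phi_sym : symmetric_monoidal_functor phi.

(** Both sides separate the four summands below [F]; passing through the
    bracketing [((p + q) + s) + u] reduces the claim to the compatibility of
    [phi] with the exchange of the two middle summands. *)
Lemma mf_interchange (p q s u : C) :
  tensm N (mf_tens phi p s) (mf_tens phi q u)
    ∘ mf_tens phi (tens M p s) (tens M q u) ∘ fmap F (interchange M p q s u)
  = interchange N (F p) (F q) (F s) (F u)
    ∘ tensm N (mf_tens phi p q) (mf_tens phi s u)
    ∘ mf_tens phi (tens M p q) (tens M s u).
Proof.
pose X x y z := tensm N (mf_tens phi x y) (idm (F z)) ∘ mf_tens phi (tens M x y) z.
have XV x y z : X x y z ∘ fmap F (massoc M x y z) = massoc N _ _ _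
    ∘ (tensm N (idm _) (mf_tens phi y z) ∘ mf_tens phi x (tens M y z)).
  by rewrite /X mf_assoc comp_assoc.
have XE x y z : X x y z
    = tensm N (mf_tens phi x y) (idm (F z)) ∘ mf_tens phi (tens M x y) z.
  by [].
clearbody X.
have VX x y z : iso_inv (massoc N _ _ _) ∘ X x y z
    = tensm N (idm _) (mf_tens phi y z) ∘ mf_tens phi x (tens M y z)
      ∘ fmap F (iso_inv (massoc M x y z)).
  by apply: (iso_inv_swap (i := fmap_iso F (massoc M x y z))); rewrite /= XV.
have swap x y z : X x y z ∘ fmap F (massoc M x y z ∘ tensm M (idm x) (sm_sym M z y)
      ∘ iso_inv (massoc M x z y))
    = massoc N _ _ _ ∘ tensm N (idm _) (sm_sym N _ _) ∘ iso_inv (massoc N _ _ _)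
      ∘ X x z y.
  rewrite !fmap_comp !comp_assoc XV -[RHS]comp_assoc VX !comp_assoc.
  rewrite (reassoc2 (mf_tens_nat phi _ _)) !comp_assoc fmap_id.
  rewrite (reassoc2 (esym (tensm_compr _ _ _ _))) phi_sym tensm_compr.
  by rewrite !comp_assoc.
have first_assoc : tensm N (mf_tens phi p s) (mf_tens phi q u)
      ∘ mf_tens phi (tens M p s) (tens M q u)
      ∘ fmap F (iso_inv (massoc M (tens M p s) q u))
    = iso_inv (massoc N _ _ _) ∘ tensm N (X p s q) (idm (F u))
      ∘ mf_tens phi (tens M (tens M p s) q) u.
  rewrite -tensm_lr -2!comp_assoc (comp_assoc _ (mf_tens phi _ _)) -VX comp_assoc.
  rewrite -tensm_id -massoc_inv_nat !XE tensm_compl -!comp_assoc.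
  by [].
have last_assoc : tensm N (X p q s) (idm (F u)) ∘ mf_tens phi (tens M (tens M p q) s) u
      ∘ fmap F (massoc M (tens M p q) s u)
    = massoc N _ _ _ ∘ tensm N (mf_tens phi p q) (mf_tens phi s u)
      ∘ mf_tens phi (tens M p q) (tens M s u).
  rewrite XE tensm_compl -(comp_assoc (tensm _ (tensm _ _ _) _)) -XE.
  rewrite -comp_assoc XV !comp_assoc -massoc_nat tensm_id.
  by rewrite -(comp_assoc (massoc _ _ _ _)) tensm_lr.
rewrite !interchangeE !fmap_comp !comp_assoc first_assoc.
rewrite (reassoc2 (mf_tens_nat phi _ _)) !comp_assoc fmap_id.
rewrite (reassoc2 (esym (tensm_compl _ _ _ _))) swap tensm_compl !comp_assoc.
by rewrite (reassoc3 last_assoc) !comp_assoc.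
Qed.
End Interchange.

(** Here [tau] is only assumed to be natural and additive in its first argument and
    normalised at the unit.  The remaining laws follow by induction on the first
    argument: an isomorphism from the target reduces each of the cases zero, one
    and sum to the corresponding axiom relating the law to [nr], [mulL] or [dr]. *)
Section Multiplication.
Variables (R S : RigCategory).
Hypothesis R_ind : generated_by_one R.
Variables (F : Functor R S) (phi : MonoidalFunctor F (bm_add R) (bm_add S)).
Hypothesis phi_sym : symmetric_monoidal_functor phi.
Variable u : Iso (F (one R)) (one S).
Variable tau : forall x y : R, Iso (F (x ⊗ y)) (F x ⊗ F y).
Hypothesis tau_natl : forall (x x' y : R) (f : Hom x x'),
  tau x' y ∘ fmap F (f ⊠ idm y) = (fmap F f ⊠ idm (F y)) ∘ tau x y.
Hypothesis tau_dr : forall x y z : R,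
  (tau x z ⊞ tau y z) ∘ mf_tens phi (x ⊗ z) (y ⊗ z) ∘ fmap F (dr x y z)
  = dr (F x) (F y) (F z) ∘ (mf_tens phi x y ⊠ idm (F z)) ∘ tau (x ⊕ y) z.
Hypothesis tau_nr : forall y : R,
  mf_unit phi ∘ fmap F (nr y)
  = nr (F y) ∘ (mf_unit phi ⊠ idm (F y)) ∘ tau (zero R) y.
Hypothesis tau_mulL : forall y : R,
  mulL (F y) ∘ (u ⊠ idm (F y)) ∘ tau (one R) y = fmap F (mulL y).

Lemma mf_unit_add :
  addL (zero S) ∘ (mf_unit phi ⊞ mf_unit phi) ∘ mf_tens phi (zero R) (zero R)
  = mf_unit phi ∘ fmap F (addL (zero R)).
Proof.
by rewrite -tensm_rl !comp_assoc mlunit_nat -(mf_lunit phi) !comp_assoc.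
Qed.

(* The isomorphisms that are applied after [tau] in [tau_dr], [tau_nr] and
   [tau_mulL]; composing an equation with them makes these laws applicable. *)
Let drphi x y z : Iso (F (x ⊕ y) ⊗ F z) (F x ⊗ F z ⊕ F y ⊗ F z) :=
  iso_comp (dr (F x) (F y) (F z))
    (iso_tens (bm_mul S) (mf_tens phi x y) (iso_id (F z))).
Let nrphi z : Iso (F (zero R) ⊗ F z) (zero S) :=
  iso_comp (nr (F z)) (iso_tens (bm_mul S) (mf_unit phi) (iso_id (F z))).
Let mulLu z : Iso (F (one R) ⊗ F z) (F z) :=
  iso_comp (mulL (F z)) (iso_tens (bm_mul S) u (iso_id (F z))).

Lemma tau_natr (x y y' : R) (g : Hom y y') :
  tau x y' ∘ fmap F (idm x ⊠ g) = (idm (F x) ⊠ fmap F g) ∘ tau x y.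
Proof.
elim/R_ind: x => [x x' i IH||| x x' IH IH'].
- apply: (iso_epi (i := fmap_iso F (iso_tens (bm_mul R) i (iso_id y)))) => /=.
  rewrite -!comp_assoc -fmap_comp tensm_swap fmap_comp comp_assoc tau_natl.
  by rewrite tau_natl -comp_assoc IH !comp_assoc tensm_swap.
- apply: (iso_mono (i := nrphi y')); rewrite /= !comp_assoc -tau_nr.
  rewrite -[LHS]comp_assoc -fmap_comp nr_nat.
  rewrite -(comp_assoc (nr _)) -tensm_swap comp_assoc nr_nat.
  exact: tau_nr.
- apply: (iso_mono (i := mulLu y')); rewrite /= !comp_assoc tau_mulL.
  rewrite -fmap_comp mlunit_nat fmap_comp -tau_mulL !comp_assoc -mlunit_nat.
  by rewrite -[in RHS](comp_assoc (mulL _)) -tensm_swap comp_assoc.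
- apply: (iso_mono (i := drphi x x' y')); rewrite /= !comp_assoc -tau_dr.
  rewrite -[LHS]comp_assoc -fmap_comp -tensm_id dr_nat fmap_comp comp_assoc.
  rewrite (reassoc2 (mf_tens_nat phi _ _)) comp_assoc -tensm_comp IH IH'.
  rewrite tensm_comp -!comp_assoc (comp_assoc (tau _ _ ⊞ _)) tau_dr.
  rewrite !comp_assoc -dr_nat tensm_id.
  by rewrite -[in RHS](comp_assoc (dr _ _ _)) -tensm_swap comp_assoc.
Qed.

Lemma tau_mulA (x y z : R) :
  (tau x y ⊠ idm (F z)) ∘ tau (x ⊗ y) z ∘ fmap F (mulA x y z)
  = mulA (F x) (F y) (F z) ∘ (idm (F x) ⊠ tau y z) ∘ tau x (y ⊗ z).
Proof.
elim/R_ind: x => [x x' i IH||| x x' IH IH'].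
- apply: (iso_epi (i := fmap_iso F (iso_tens (bm_mul R) i (iso_id (y ⊗ z))))) => /=.
  rewrite -[RHS]comp_assoc tau_natl [RHS]comp_assoc.
  rewrite -(comp_assoc (mulA _ _ _)) tensm_swap !comp_assoc -!tensm_id massoc_nat.
  rewrite (reassoc3 (esym IH)) -[LHS]comp_assoc -fmap_comp.
  rewrite massoc_nat fmap_comp !comp_assoc (reassoc2 (tau_natl _ _)) comp_assoc.
  by rewrite -tensm_compl tau_natl tensm_compl.
- apply: (iso_mono (i := iso_comp (nr (F z)) (iso_tens _ (nrphi y) (iso_id _)))).
  rewrite /= !comp_assoc (reassoc2 (esym (tensm_compl _ _ _ _))) -tau_nr.
  rewrite !tensm_compl !comp_assoc (reassoc2 (esym (tau_natl _ _))) !comp_assoc.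
  rewrite -tau_nr (reassoc2 (esym (fmap_comp _ _ _))).
  rewrite (reassoc2 (esym (massoc_nat _ _ _ _))) tensm_id !comp_assoc nr_mulA.
  rewrite (reassoc2 (esym (tensm_swap _ _ _))) !comp_assoc nr_nat -tau_nr.
  by rewrite -[LHS]comp_assoc -fmap_comp comp_assoc nr_mulA.
- apply: (iso_mono (i := iso_tens _ (mulLu y) (iso_id (F z)))).
  rewrite /= !comp_assoc -tensm_compl tau_mulL -tau_natl.
  rewrite -comp_assoc -fmap_comp mlunit_tens.
  rewrite tensm_compl (reassoc2 (esym (massoc_nat _ _ _ _))) tensm_id !comp_assoc.
  rewrite mlunit_tens (reassoc2 (esym (tensm_swap _ _ _))) !comp_assoc mlunit_nat.
  by rewrite -!comp_assoc -tau_mulL !comp_assoc.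
- apply: (iso_mono (i := iso_comp (dr _ _ (F z)) (iso_tens _ (drphi x x' y) (iso_id _)))).
  rewrite /= !comp_assoc (reassoc2 (esym (tensm_compl _ _ _ _))) -tau_dr.
  rewrite !tensm_compl !comp_assoc (reassoc2 (esym (tau_natl _ _))) !comp_assoc.
  rewrite dr_nat (reassoc3 (esym (tau_dr _ _ _))) !comp_assoc.
  rewrite -!comp_assoc -!fmap_comp (comp_assoc (dr _ _ _)) dr_mulA fmap_comp.
  rewrite [X in _ ∘ (_ ∘ X)]comp_assoc mf_tens_nat -[X in _ ∘ (_ ∘ X)]comp_assoc.
  rewrite [X in _ ∘ X]comp_assoc -tensm_comp [LHS]comp_assoc -tensm_comp.
  rewrite (comp_assoc (tau x y ⊠ _)) (comp_assoc (tau x' y ⊠ _)) IH IH'.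
  rewrite (tensm_comp _ _ (tau _ _)) -[LHS]comp_assoc [X in _ ∘ X]comp_assoc tau_dr.
  rewrite [RHS]comp_assoc !comp_assoc (reassoc2 (esym (massoc_nat _ _ _ _))).
  rewrite tensm_id comp_assoc dr_mulA (reassoc2 (esym (tensm_swap _ _ _))) !comp_assoc.
  by rewrite -tensm_id (reassoc2 (dr_nat _ _ _)) !comp_assoc -tensm_comp.
Qed.

Lemma tau_mulR (x : R) :
  mulR (F x) ∘ (idm (F x) ⊠ u) ∘ tau x (one R) = fmap F (mulR x).
Proof.
elim/R_ind: x => [x x' i IH||| x x' IH IH'].
- apply: (iso_epi (i := fmap_iso F (iso_tens (bm_mul R) i (iso_id (one R))))) => /=.
  rewrite -[LHS]comp_assoc tau_natl !comp_assoc -(comp_assoc (mulR _)) tensm_swap.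
  rewrite comp_assoc mrunit_nat -!comp_assoc (comp_assoc (mulR _)) IH -!fmap_comp.
  by rewrite mrunit_nat.
- apply: (iso_mono (i := mf_unit phi)).
  rewrite -nr_one tau_nr !comp_assoc -mrunit_nat.
  by rewrite -(comp_assoc (mulR _)) -tensm_swap comp_assoc -nr_one nr_nat.
- apply: (iso_mono (i := u)).
  rewrite -munit_lr -tau_mulL !comp_assoc -mrunit_nat -munit_lr -mlunit_nat.
  by rewrite (reassoc2 (tensm_swap _ _ _)) !comp_assoc.
- apply: (iso_mono (i := mf_tens phi x x')).
  rewrite -(dr_mulR x x') fmap_comp !comp_assoc mf_tens_nat -IH -IH' tensm_comp.
  rewrite -mrunit_nat -dr_mulR (reassoc3 (tau_dr _ _ _)) !comp_assoc tensm_comp.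
  rewrite -(comp_assoc _ _ (dr _ _ _)) -dr_nat tensm_id !comp_assoc.
  by rewrite (reassoc2 (esym (tensm_swap _ _ _))) !comp_assoc.
Qed.

Lemma tau_nl (x : R) :
  mf_unit phi ∘ fmap F (nl x)
  = nl (F x) ∘ (idm (F x) ⊠ mf_unit phi) ∘ tau x (zero R).
Proof.
elim/R_ind: x => [x x' i IH||| x x' IH IH'].
- apply: (iso_epi (i := fmap_iso F (iso_tens (bm_mul R) i (iso_id (zero R))))) => /=.
  rewrite -comp_assoc -fmap_comp nl_nat IH -[RHS]comp_assoc tau_natl !comp_assoc.
  by rewrite (reassoc2 (tensm_swap _ _ _)) !comp_assoc nl_nat.
- rewrite nl_nr_zero tau_nr -(nl_nat (mf_unit phi)) -(nr_nat (mf_unit phi)).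
  by rewrite nl_nr_zero (reassoc2 (tensm_swap _ _ _)) !comp_assoc.
- rewrite nl_one -tau_mulL !comp_assoc -mlunit_nat -(nl_nat u) nl_one.
  by rewrite (reassoc2 (tensm_swap _ _ _)) !comp_assoc.
- rewrite -nl_add !fmap_comp !comp_assoc -mf_unit_add (reassoc2 (mf_tens_nat phi _ _)).
  rewrite comp_assoc (reassoc2 (esym (tensm_comp _ _ _ _ _))) IH IH' !tensm_comp.
  rewrite !comp_assoc (reassoc3 (tau_dr _ _ _)) !comp_assoc (reassoc2 (esym (dr_nat _ _ _))).
  rewrite tensm_id !comp_assoc nl_add (reassoc2 (tensm_swap _ _ _)) !comp_assoc.
  by rewrite nl_nat.
Qed.

(** The case of a sum is the one place where distributing on both sides meets the
    interchange of the four resulting summands. *)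
Lemma tau_dl (x y z : R) :
  (tau x y ⊞ tau x z) ∘ mf_tens phi (x ⊗ y) (x ⊗ z) ∘ fmap F (dl x y z)
  = dl (F x) (F y) (F z) ∘ (idm (F x) ⊠ mf_tens phi y z) ∘ tau x (y ⊕ z).
Proof.
elim/R_ind: x => [x x' i IH||| x x' IH IH'].
- apply: (iso_epi (i := fmap_iso F (iso_tens (bm_mul R) i (iso_id (y ⊕ z))))) => /=.
  rewrite -[RHS]comp_assoc tau_natl [RHS]comp_assoc (reassoc2 (tensm_swap _ _ _)).
  rewrite -!tensm_id !comp_assoc dl_nat (reassoc3 (esym IH)).
  rewrite -[LHS]comp_assoc -fmap_comp dl_nat fmap_comp !comp_assoc.
  by rewrite (reassoc2 (mf_tens_nat phi _ _)) comp_assoc -!tensm_comp !tau_natl.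
- apply: (iso_mono (i := iso_comp (mlunit (bm_add S) (zero S))
                                  (iso_tens (bm_add S) (nrphi y) (nrphi z)))).
  rewrite /= !comp_assoc (reassoc2 (esym (tensm_comp _ _ _ _ _))) -!tau_nr tensm_comp.
  rewrite !comp_assoc (reassoc2 (esym (mf_tens_nat phi _ _))) comp_assoc mf_unit_add.
  rewrite -!comp_assoc -!fmap_comp comp_assoc nr_add.
  rewrite (tensm_comp _ (nr _)) !comp_assoc (reassoc2 (esym (dl_nat _ _ _))).
  rewrite tensm_id !comp_assoc nr_add (reassoc2 (esym (tensm_swap _ _ _))) !comp_assoc.
  by rewrite nr_nat tau_nr.
- apply: (iso_mono (i := iso_tens (bm_add S) (mulLu y) (mulLu z))).
  rewrite /= !comp_assoc -tensm_comp !tau_mulL -mf_tens_nat.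
  rewrite -[LHS]comp_assoc -fmap_comp dl_mulL -tau_mulL.
  rewrite tensm_comp (reassoc2 (esym (dl_nat _ _ _))).
  rewrite tensm_id !comp_assoc dl_mulL (reassoc2 (esym (tensm_swap _ _ _))) !comp_assoc.
  by rewrite mlunit_nat.
- apply: (iso_mono (i := iso_tens (bm_add S) (drphi x x' y) (drphi x x' z))).
  rewrite /= !comp_assoc -tensm_comp -!tau_dr tensm_comp.
  rewrite (reassoc2 (esym (mf_tens_nat phi _ _))) comp_assoc -[LHS]comp_assoc -fmap_comp.
  rewrite -dl_dr_interchange 2!fmap_comp tensm_comp !comp_assoc.
  rewrite (reassoc3 (mf_interchange phi_sym _ _ _ _)) (comp_assoc _ _ (mf_tens phi _ _)).
  rewrite (comp_assoc _ _ (mf_tens phi _ _ ⊞ _)) -interchange_nat.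
  rewrite (reassoc2 (mf_tens_nat phi _ _)) !comp_assoc.
  rewrite !(reassoc2 (esym (tensm_comp _ _ _ _ _))) !comp_assoc IH IH'.
  rewrite (tensm_comp _ (dr _ _ _)) (reassoc2 (esym (dl_nat _ _ _))).
  rewrite tensm_id !comp_assoc -dl_dr_interchange.
  rewrite (reassoc2 (esym (tensm_swap _ _ _))) !comp_assoc -tensm_id.
  rewrite (reassoc2 (dr_nat _ _ _)) !comp_assoc (tensm_comp _ _ (tau _ _)).
  rewrite !comp_assoc (reassoc3 (tau_dr _ _ _)) !comp_assoc.
  by rewrite (reassoc2 (esym (tensm_comp _ _ _ _ _))).
Qed.

Definition rig_hom_of_additive : RigHom R S.
Proof.
unshelve refine (@Build_RigHom R S F phi
  (@Build_MonoidalFunctor R S F (bm_mul R) (bm_mul S) tau u _ _ _ _) phi_sym _ _ _ _).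
- by move=> x x' y y' f g; rewrite -tensm_rl fmap_comp comp_assoc tau_natr
    -comp_assoc tau_natl comp_assoc tensm_rl.
- exact: tau_mulA.
- exact: tau_mulL.
- exact: tau_mulR.
- exact: tau_dl.
- by move=> x y z; exact: tau_dr.
- exact: tau_nl.
- exact: tau_nr.
Defined.

End Multiplication.

Section RigTransformations.
Variables (R S : RigCategory).
Hypothesis R_ind : generated_by_one R.
Variables (G H : RigHom R S) (t : NatTrans G H).
Hypothesis t_add : monoidal_transformation (rh_add G) (rh_add H) t.
Hypothesis t_one : mf_unit (rh_mul H) ∘ t (one R) = mf_unit (rh_mul G).

(** The compatibility with products is proved by induction on the first factor,
    along the same lines as the laws of [tau]. *)
Lemma additive_transformation_mul :
  monoidal_transformation (rh_mul G) (rh_mul H) t.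
Proof.
case: t_add => t_plus t_zero; split=> // x y.
elim/R_ind: x => [x x' i IH||| x x' IH IH'].
- apply: (iso_epi (i := fmap_iso G (iso_tens (bm_mul R) i (iso_id y)))) => /=.
  rewrite -[LHS]comp_assoc nt_nat comp_assoc mf_tens_nat -[LHS]comp_assoc IH.
  rewrite -[RHS]comp_assoc mf_tens_nat !comp_assoc -!tensm_comp nt_nat !fmap_id.
  by rewrite comp_idl comp_idr.
- apply: (iso_mono (i := iso_comp (nr (H y))
    (iso_tens _ (mf_unit (rh_add H)) (iso_id (H y))))) => /=.
  rewrite !comp_assoc -rh_nr -[LHS]comp_assoc -nt_nat comp_assoc t_zero rh_nr.
  rewrite (reassoc2 (esym (tensm_comp _ _ _ _ _))) t_zero comp_idl.
  by rewrite -(tensm_rl _ _ (t y)) comp_assoc nr_nat.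
- apply: (iso_mono (i := iso_comp (mulL (H y))
    (iso_tens _ (mf_unit (rh_mul H)) (iso_id (H y))))) => /=.
  rewrite !comp_assoc mf_lunit -nt_nat -(mf_lunit (rh_mul G)).
  rewrite (reassoc2 (esym (tensm_comp _ _ _ _ _))) t_one comp_idl.
  rewrite -(tensm_rl _ _ (t y)).
  by rewrite !comp_assoc mlunit_nat.
- apply: (iso_mono (i := iso_comp (dr (H x) (H x') (H y))
    (iso_tens _ (mf_tens (rh_add H) x x') (iso_id (H y))))) => /=.
  rewrite !comp_assoc -rh_dr -[LHS]comp_assoc -nt_nat comp_assoc.
  rewrite (reassoc2 (t_plus _ _)) comp_assoc -tensm_comp IH IH'.
  rewrite (reassoc2 (esym (tensm_comp _ _ _ _ _))) t_plus comp_idl tensm_comp.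
  rewrite (reassoc3 (rh_dr _ _ _ _)) !comp_assoc -dr_nat.
  by rewrite (reassoc2 (esym (tensm_comp _ _ _ _ _))) comp_idr.
Qed.

End RigTransformations.

(** * Right multiplication as a symmetric monoidal functor *)

Section Composite.
Variables (C D E : Category) (F : Functor C D) (G : Functor D E).
Variables (M : SymMonoidal C) (N : SymMonoidal D) (P : SymMonoidal E).
Variables (phi : MonoidalFunctor F M N) (psi : MonoidalFunctor G N P).

Lemma mf_tens_natl (x x' y : D) (f : Hom x x') :
  tensm P (fmap G f) (idm (G y)) ∘ mf_tens psi x y
  = mf_tens psi x' y ∘ fmap G (tensm N f (idm y)).
Proof. by rewrite mf_tens_nat fmap_id. Qed.

Lemma mf_tens_natr (x y y' : D) (f : Hom y y') :
  tensm P (idm (G x)) (fmap G f) ∘ mf_tens psi x y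
  = mf_tens psi x y' ∘ fmap G (tensm N (idm x) f).
Proof. by rewrite mf_tens_nat fmap_id. Qed.

Program Definition comp_monoidal : MonoidalFunctor (functor_comp G F) M P :=
  {| mf_tens := fun x y =>
       iso_comp (mf_tens psi (F x) (F y)) (fmap_iso G (mf_tens phi x y));
     mf_unit := iso_comp (mf_unit psi) (fmap_iso G (mf_unit phi)) |}.
Next Obligation.
move=> x x' y y' f g /=; rewrite -comp_assoc -fmap_comp mf_tens_nat fmap_comp.
by rewrite comp_assoc mf_tens_nat comp_assoc.
Qed.
Next Obligation.
move=> x y z /=.
rewrite tensm_compl tensm_compr !comp_assoc !(reassoc2 (mf_tens_natl _ _)).
rewrite (reassoc2 (mf_tens_natr _ _)) !comp_assoc -(mf_assoc psi).
rewrite -!comp_assoc -!fmap_comp; congr (_ ∘ (_ ∘ fmap G _)).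
by rewrite !comp_assoc mf_assoc.
Qed.
Next Obligation.
move=> x /=; rewrite tensm_compl !comp_assoc (reassoc2 (mf_tens_natl _ _)).
by rewrite !comp_assoc (mf_lunit psi) -!fmap_comp mf_lunit.
Qed.
Next Obligation.
move=> x /=; rewrite tensm_compr !comp_assoc (reassoc2 (mf_tens_natr _ _)).
by rewrite !comp_assoc (mf_runit psi) -!fmap_comp mf_runit.
Qed.

Lemma comp_symmetric : symmetric_monoidal_functor phi ->
  symmetric_monoidal_functor psi -> symmetric_monoidal_functor comp_monoidal.
Proof.
move=> phi_sym psi_sym x y /=.
by rewrite -comp_assoc -fmap_comp phi_sym fmap_comp comp_assoc psi_sym comp_assoc.
Qed.

End Composite.

Lemma iso_conj_invK (C : Category) (x y z : C) (i : Iso y z) (f : Hom x z) :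
  i ∘ (iso_inv i ∘ f) = f.
Proof. by rewrite comp_assoc iso_morK comp_idl. Qed.

Section RightMultiplication.
Variables (S : RigCategory) (b : S).

Program Definition rmul : Functor S S :=
  {| fobj := fun x => x ⊗ b; fmap := fun x y f => f ⊠ idm b |}.
Next Obligation. by move=> x; exact: tensm_id. Qed.
Next Obligation. by move=> *; exact: tensm_compl. Qed.

Program Definition rmul_monoidal : MonoidalFunctor rmul (bm_add S) (bm_add S) :=
  {| mf_tens := fun x y => dr x y b; mf_unit := nr b |}.
Next Obligation. by move=> *; exact: dr_nat. Qed.
Next Obligation. by move=> *; exact: dr_addA. Qed.
Next Obligation. by move=> *; exact: dr_addL. Qed.
Next Obligation. by move=> *; exact: dr_addR. Qed.

Lemma rmul_symmetric : symmetric_monoidal_functor rmul_monoidal.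
Proof. by move=> x y; exact: dr_addC. Qed.

End RightMultiplication.

Lemma FSet_rig_generated : generated_by_one FSet_rig.
Proof.
move=> P Piso; apply: finType_ind => X Y e; exact: (Piso X Y (FSet_iso e)).
Qed.

(** * The homomorphism out of finite sets *)

Section BiinitialHom.
Variable S : RigCategory.

Let F : Functor FSet_rig S := free_fun (bm_add S) (one S).
Let phi : MonoidalFunctor F FSet_add (bm_add S) := free_monoidal (bm_add S) (one S).
Let u : Iso (F (one FSet_rig)) (one S) := free_one (bm_add S) (one S).

Definition mul_comparison_one (y : FSet_rig) :
    Iso (F (one FSet_rig ⊗ y)) (F (one FSet_rig) ⊗ F y) :=
  iso_comp (iso_sym (iso_comp (mulL (F y)) (iso_tens _ u (iso_id (F y)))))
    (fmap_iso F (mulL y)).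

(** For fixed [y] the two sides are symmetric monoidal functors of [x]: one
    multiplies by [y] before applying [F], the other multiplies by [F y]
    afterwards. *)
Definition mul_comparison (x y : FSet_rig) : Iso (F (x ⊗ y)) (F x ⊗ F y) :=
  extend (comp_monoidal (M := bm_add FSet_rig) (rmul_monoidal y) phi)
      (comp_monoidal (M := bm_add FSet_rig) phi (rmul_monoidal (F y)))
      (mul_comparison_one y) x.

Let phi_sym : symmetric_monoidal_functor phi := free_symmetric _ _.

Let left_sym (y : FSet_rig) :
  symmetric_monoidal_functor
    (comp_monoidal (M := bm_add FSet_rig) (rmul_monoidal y) phi) :=
  comp_symmetric (@rmul_symmetric FSet_rig y) phi_sym.

Let right_sym (y : FSet_rig) :
  symmetric_monoidal_functor
    (comp_monoidal (M := bm_add FSet_rig) phi (rmul_monoidal (F y))) :=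
  comp_symmetric phi_sym (rmul_symmetric (F y)).

Definition FSet_hom : RigHom FSet_rig S.
Proof.
apply: (@rig_hom_of_additive FSet_rig S FSet_rig_generated F phi phi_sym u mul_comparison).
- by move=> x x' y f; exact: (extend_nat (left_sym y) (right_sym y)).
- move=> x y z; rewrite -[LHS]comp_assoc.
  exact: esym (extend_add (left_sym z) (right_sym z) (mul_comparison_one z) x y).
- by move=> y; exact: esym (extend_zero (left_sym y) (right_sym y) (mul_comparison_one y)).
- move=> y; rewrite /mul_comparison (extend_unit (left_sym y) (right_sym y)).
  rewrite /mul_comparison_one /=.
  exact: (iso_conj_invK (iso_comp (mulL (F y)) (iso_tens _ u (iso_id (F y))))).
Defined.

End BiinitialHom.

(** * Uniqueness of transformations *)

Section Comparison.
Variables (S : RigCategory) (G H : RigHom FSet_rig S).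

Let f : Iso (G (one FSet_rig)) (H (one FSet_rig)) :=
  iso_comp (iso_sym (mf_unit (rh_mul H))) (mf_unit (rh_mul G)).
Let G_sym : symmetric_monoidal_functor (M := FSet_add) (rh_add G) := @rh_add_sym _ _ G.
Let H_sym : symmetric_monoidal_functor (M := FSet_add) (rh_add H) := @rh_add_sym _ _ H.

(** The compatibility with the multiplicative units leaves only the component [f]
    at the point, which then determines the whole transformation. *)
Definition comparison_nt : NatTrans G H :=
  {| nt := fun X : FSet_rig => iso_mor (extend (rh_add G) (rh_add H) f X);
     nt_nat := extend_nat G_sym H_sym f |}.

Lemma comparison_add : monoidal_transformation (rh_add G) (rh_add H) comparison_nt.
Proof. by split; [exact: (extend_add G_sym H_sym) | exact: (extend_zero G_sym H_sym)]. Qed.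

Lemma comparison_one :
  mf_unit (rh_mul H) ∘ comparison_nt (one FSet_rig) = mf_unit (rh_mul G).
Proof.
rewrite [comparison_nt _](extend_unit G_sym H_sym f) /=.
by rewrite comp_assoc iso_morK comp_idl.
Qed.

Definition comparison : RigTrans G H :=
  {| rt_add := comparison_add;
     rt_mul := additive_transformation_mul FSet_rig_generated comparison_add comparison_one |}.

Lemma comparison_uniq (s t : RigTrans G H) : s = t.
Proof.
apply: RigTrans_ext; apply: (monoidal_transformation_uniq (rt_add s) (rt_add t)).
apply: (iso_mono (i := mf_unit (rh_mul H))).
by rewrite (proj2 (rt_mul s)) (proj2 (rt_mul t)).
Qed.

End Comparison.

Theorem theorem4p3p3 (S : RigCategory) :
  equivalent_categories (Hom_RigCat FSet_hat S) terminal_category.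
Proof.
pose C := Hom_RigCat FSet_hat S.
pose iso (G H : C) : Iso G H :=
  {| iso_mor := comparison G H : @Hom C G H; iso_inv := comparison H G : @Hom C H G;
     iso_invK := comparison_uniq _ _; iso_morK := comparison_uniq _ _ |}.
unshelve eexists; last unshelve eexists.
- by exists (fun _ => tt) (fun _ _ _ => tt).
- by exists (fun _ => FSet_hom S : C) (fun _ _ _ => idm (FSet_hom S : C)) => // *;
    rewrite comp_idl.
- split; constructor.
  + by exists (fun G : C => iso (FSet_hom S) G) => *; exact: comparison_uniq.
  + by exists (fun x => @Build_Iso terminal_category tt x tt tt erefl erefl).
Qed.
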